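(* Let $B,C>0$ and $\delta$ be fixed parameters, and for each (sufficiently large) $n$ let $X=X^{(n)}=(X_{ij})$ be uniformly distributed on the set $\mathscr{M}^{\{0,1\}}_{n,\delta}(B,C)$ of binary contingency tables. Fix $\varepsilon>0$. Then for all integers $k\ge1$, as $n\to\infty$: (1) (Bottom right) If $0\le\delta<1$, $0<C\le1$ and $0<B\le\frac1C$, then $$\left|\mathbb E\left[X_{n+1,n+1}^k\right]-C\right|=O\left(n^{\delta-1}+n^{-\frac12+\varepsilon}\right).$$ (2) (Top left) If $\frac12<\delta<1$, $0<C<\frac34$ and $0<B<\dfrac{1}{\sqrt{\frac C3-\frac{C^2}3}+C}$, then $$\left|\mathbb E\left[X_{11}^k\right]-\frac{B^2(1-C)}{B^2-2B+1/C}\right|=O\left(n^{\delta-1}+n^{\frac12-\delta+\varepsilon}\right).$$ (3) (Side blocks) If $0<\delta<1$, $0<C<\frac34$ and $0<B<\dfrac{1}{\sqrt{\frac C3-\frac{C^2}3}+C}$, then $$\left|\mathbb E\left[X_{1,n+1}^k\right]-BC\right|=O\left(n^{\delta-1}+n^{-\frac\delta2+\varepsilon}\right).$$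
   Context: $[x]$ denotes the integer part of $x$. For integer vectors $\mathbf r=(r_1,\dots,r_m)$, $\mathbf c=(c_1,\dots,c_l)$ with $\sum_i r_i=\sum_j c_j$, $\mathscr{M}^{\{0,1\}}(\mathbf r,\mathbf c)$ is the set of $m\times l$ matrices with entries in $\{0,1\}$ whose $i$th row sum is $r_i$ and $j$th column sum is $c_j$ for all $i,j$. For $B,C>0$, $0\le\delta\le1$ and $n\ge1$, $\mathscr{M}^{\{0,1\}}_{n,\delta}(B,C):=\mathscr{M}^{\{0,1\}}(\widetilde{\mathbf r},\widetilde{\mathbf c})$, where $\widetilde{\mathbf r}=\widetilde{\mathbf c}\in\mathbb N^{[n^\delta]+n}$ is the vector whose first $[n^\delta]$ entries equal $[BCn]$ and whose remaining $n$ entries equal $[Cn]$. Implied constants in $O(\cdot)$ do not depend on $n$. *)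

(* Defs.v *)
From mathcomp Require Import all_boot all_order all_algebra.
From mathcomp Require Import all_classical all_reals all_analysis.
Set Implicit Arguments.
Unset Strict Implicit.
Unset Printing Implicit Defensive.
Import Order.TTheory GRing.Theory Num.Theory.
Import numFieldNormedType.Exports.
Local Open Scope classical_set_scope.
Local Open Scope ring_scope.

(* {0,1}-matrices are represented by boolean matrices, with true read as 1. *)
Definition binary_tables (m l : nat) (r : 'I_m -> nat) (c : 'I_l -> nat) :
    {set 'M[bool]_(m, l)} :=
  [set A : 'M[bool]_(m, l) |
     [forall i, (\sum_(j < l) A i j)%N == r i]
       && [forall j, (\sum_(i < m) A i j)%N == c j]]%SET.

(* [n^delta] + n; the arguments of Num.truncn below are nonnegative in all
   uses, so that it is the integer part. *)
Definition table_size (R : realType) (delta : R) (n : nat) : nat :=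
  (Num.truncn (n%:R `^ delta) + n)%N.

Definition margin (R : realType) (B C delta : R) (n : nat)
    (i : 'I_(table_size delta n)) : nat :=
  if (i < Num.truncn ((n%:R : R) `^ delta))%N
  then Num.truncn (B * C * n%:R) else Num.truncn (C * n%:R).

Definition tables (R : realType) (B C delta : R) (n : nat) :
    {set 'M[bool]_(table_size delta n)} :=
  binary_tables (@margin R B C delta n) (@margin R B C delta n).

(* Entry (i, j) of A with rows and columns counted from 1 as in X_{11} and
   X_{n+1,n+1}. It is extended by 0 outside of the table, because n.+1 is not
   a valid index of the empty table that arises for n = 0 and delta != 0; see
   entryE and table_size_gt. *)
Definition entry (R : realType) (m l : nat) (A : 'M[bool]_(m, l)) (i j : nat) :
    R :=
  match i, j with
  | i'.+1, j'.+1 =>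
      match (insub i' : option 'I_m), (insub j' : option 'I_l) with
      | Some a, Some b => (A a b)%:R
      | _, _ => 0
      end
  | _, _ => 0
  end.

Lemma entryE (R : realType) (m l : nat) (A : 'M[bool]_(m, l)) (i : 'I_m)
    (j : 'I_l) : entry R A i.+1 j.+1 = (A i j)%:R.
Proof. by rewrite /entry !valK. Qed.

Lemma table_size_gt (R : realType) (delta : R) (n : nat) :
  0 <= delta -> (0 < n)%N -> (n < table_size delta n)%N.
Proof.
move=> d0 n0; rewrite /table_size -[ltnLHS]add0n ltn_add2r truncn_gt_nat.
by rewrite -[leLHS](powRr0 (n%:R : R)) ler_powR// ler1n.
Qed.

(* X is a random variable that is uniformly distributed on the set S; since
   the total mass is 1, this forces S to be nonempty. *)
Definition uniform_on (R : realType) (d : measure_display)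
    (T : measurableType d) (P : probability T R) (U : finType) (X : T -> U)
    (S : {set U}) : Prop :=
  forall u : U, measurable (X @^-1` [set u]) /\
    P (X @^-1` [set u]) = (if u \in S then (#|S|%:R : R)^-1 else 0)%:E.

(* Main.v *)
Require Import Defs.
From mathcomp Require Import all_boot all_order all_algebra.
From mathcomp Require Import all_classical all_reals all_analysis.
From mathcomp Require Import perm ring lra zify.
Set Implicit Arguments.
Unset Strict Implicit.
Unset Printing Implicit Defensive.
Import Order.TTheory GRing.Theory Num.Theory.
Import numFieldNormedType.Exports.
Local Open Scope classical_set_scope.
Local Open Scope ring_scope.

(** Throughout, q = BC, the first m = [n^delta] rows and columns, with margins about
q n, are called heavy, the n others, with margins about C n, are called light, and
N = m + n.

Two of the three limits are forced by the margins alone.  A row has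
only m entries in heavy columns, and its n entries in light columns have the same
mean because columns of equal margin may be permuted.  Hence n times this mean is the
prescribed row sum up to m (mean_bottom_column), which gives the values C and BC
with error O(m / n) = O(n^(delta - 1)).

The top left entry is governed by a switching.  Exchanging the two diagonals of
the square on rows 1, i and columns 1, j preserves all margins, so the patterns
X_11 = X_ij = 1, X_1j = X_i1 = 0 and X_11 = X_ij = 0, X_1j = X_i1 = 1 are equally
likely (switching_identity).  Sum this over light i and j.  Row 1 and column 1 have
about q n light ones each, and if the light block is quasirandom, i.e. if each of
its subrectangles has density C up to a small error, then the two sides are about
E[X_11] C (1 - q)^2 n^2 and (1 - E[X_11]) (1 - C) q^2 n^2 (square_gap_near,
top_left_mean).  Solving for E[X_11] gives the stated limit.

Quasirandomness comes from comparing the uniform table with independent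
Bernoulli entries whose success probabilities p1 = q, p2 = q (1 - m / n),
p3 = C - p2 m / n on the blocks make every expected margin right.  Three facts
make the comparison work.

- A Chernoff bound and a union bound over the 4^N rectangles control the
  probability that some rectangle sum deviates by lam (bern_large_disc).

- The product measure gives the set of tables mass at least
  exp(- O(n^(3/2) log n)) (bern_with_margins).  Indeed, with probability at least
  1/2 no rectangle sum deviates by more than 6 N sqrt N; such a matrix becomes a
  table after O(N sqrt N) changes of entries (repair_table), and a Hamming ball
  of that radius has a controlled mass (bern_ball).

- The log odds are of the form a_i + b_j except on the m^2 entries where heavy
  rows and columns meet, so the weights of two tables differ at most by a factor
  exp(O(m^2)) (bern_ratio).

Consequently the uniform measure of the tables with a deviation lam is at most
exp(O(n^(3/2) log n) + O(m^2) - lam^2 / (8 N^2)), which is below 1 / n for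
lam = n (n^(3/4 + eps/2) + K m) (uniform_large_disc, failure_le).  The relative
error lam / n^2 is acceptable because n^(-1/4 + eps/2) is the geometric mean of
n^(delta - 1) and n^(1/2 - delta + eps). *)

(** * Products of Bernoulli measures *)

Definition bern (R : realType) (T : finType) (p : T -> R)
    (f : {ffun T -> bool}) : R :=
  \prod_x (if f x then p x else 1 - p x).

Definition dev (R : realType) (T : finType) (p : T -> R)
    (f : {ffun T -> bool}) (S : {set T}) : R :=
  \sum_(x in S) ((f x)%:R - p x).

Lemma sum_bern_prod (R : realType) (T : finType) (p : T -> R)
    (g : T -> bool -> R) :
  \sum_f bern p f * (\prod_x g x (f x)) =
  \prod_x (p x * g x true + (1 - p x) * g x false).
Proof.
transitivity (\sum_(f : {ffun T -> bool})
   \prod_x ((if f x then p x else 1 - p x) * g x (f x))).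
  by apply: eq_bigr => f _; rewrite big_split.
rewrite -(bigA_distr_bigA (fun x b => (if b then p x else 1 - p x) * g x b)).
by apply: eq_bigr => x _; rewrite big_bool.
Qed.

Lemma sum_bern (R : realType) (T : finType) (p : T -> R) :
  \sum_f bern p f = 1.
Proof.
have := sum_bern_prod p (fun _ _ => 1).
rewrite /=; under eq_bigr do rewrite prodr_const expr1n mulr1.
move=> ->; rewrite big1 // => x _; by rewrite !mulr1 subrKC.
Qed.

Lemma bern_gt0 (R : realType) (T : finType) (p : T -> R) f :
  (forall x, 0 < p x < 1) -> 0 < bern p f.
Proof.
move=> hp; apply: prodr_gt0 => x _; have /andP[? ?] := hp x.
by case: ifP => _ //; rewrite subr_gt0.
Qed.

(** Uses expR y <= 1 / (1 - y), the inverse of 1 - y <= expR (- y). *)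
Lemma expR_le_quad (R : realType) (y : R) :
  y <= 1 / 2 -> expR y <= 1 + y + 2 * y ^+ 2.
Proof.
move=> hy; have h1 : 1 - y <= expR (- y) by exact: expR_ge1Dx.
have hy1 : 0 < 1 - y by lra.
rewrite -[expR y]opprK -[y in expR y]opprK expRN opprK.
apply: (@le_trans _ _ (1 - y)^-1).
  by rewrite lef_pV2 ?posrE ?expR_gt0.
rewrite -[X in X <= _]mul1r ler_pdivrMr //.
have : 0 <= y ^+ 2 * (1 - 2 * y) by apply: mulr_ge0; [exact: sqr_ge0 | lra].
nra.
Qed.

(** The first-order terms of expR_le_quad cancel since the entry is centred. *)
Lemma bern_mgf1 (R : realType) (p t : R) : 0 <= p <= 1 -> `|t| <= 1 / 2 ->
  p * expR (t * (1 - p)) + (1 - p) * expR (t * (0 - p)) <= expR (2 * t ^+ 2).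
Proof.
move=> /andP[p0 p1]; rewrite ler_norml => /andP[t0 t1].
have h1 : t * (1 - p) <= 1 / 2 by nra.
have h2 : t * (0 - p) <= 1 / 2 by nra.
apply: le_trans (expR_ge1Dx _).
have e1 := expR_le_quad h1; have e2 := expR_le_quad h2.
have q1 : 0 <= 1 - p by lra.
have := lerD (ler_wpM2l p0 e1) (ler_wpM2l q1 e2).
move=> /le_trans; apply.
have -> : p * (1 + t * (1 - p) + 2 * (t * (1 - p)) ^+ 2) +
  (1 - p) * (1 + t * (0 - p) + 2 * (t * (0 - p)) ^+ 2) =
  1 + 2 * t ^+ 2 * (p * (1 - p)) by ring.
have : 0 <= t ^+ 2 by exact: sqr_ge0.
have : p * (1 - p) <= 1 by nra.
nra.
Qed.

Lemma bern_mgf (R : realType) (T : finType) (p : T -> R) (S : {set T}) (t : R) :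
  (forall x, 0 < p x < 1) -> `|t| <= 1 / 2 ->
  \sum_f bern p f * expR (t * dev p f S) <= expR (2 * t ^+ 2 * #|T|%:R).
Proof.
move=> hp ht.
have E f : expR (t * dev p f S) =
    \prod_x (if x \in S then expR (t * ((f x)%:R - p x)) else 1).
  by rewrite /dev mulr_sumr expR_sum -big_mkcond.
under eq_bigr do rewrite E.
rewrite (sum_bern_prod p
  (fun x b => if x \in S then expR (t * (b%:R - p x)) else 1)).
have -> : expR (2 * t ^+ 2 * #|T|%:R) = \prod_(x : T) expR (2 * t ^+ 2).
  rewrite prodr_const expRM_natr; congr (_ ^+ _).
apply: ler_prod => x _; have /andP[p0 p1] := hp x.
have q0 : 0 <= 1 - p x by rewrite subr_ge0 ltW.
case: ifP => _.
  by rewrite addr_ge0 ?mulr_ge0 ?expR_ge0 ?(ltW p0) //= bern_mgf1 // !ltW.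
rewrite !mulr1 subrKC ler01 /=.
by rewrite -expR0 ler_expR mulr_ge0 // sqr_ge0.
Qed.

Lemma dev_le_card (R : realType) (T : finType) (p : T -> R) f (S : {set T}) :
  (forall x, 0 < p x < 1) -> `|dev p f S| <= #|T|%:R.
Proof.
move=> hp; apply: le_trans (ler_norm_sum _ _ _) _.
apply: (@le_trans _ _ (\sum_(x in S) 1)).
  apply: ler_sum => x _; have /andP[p0 p1] := hp x.
  by rewrite ler_norml; case: (f x) => /=; apply/andP; split; lra.
by rewrite sumr_const ler_nat max_card.
Qed.

(** Markov for expR (t * dev) with the optimal t = lam / (4 |T|); the condition
t <= 1/2 of bern_mgf is free, because a deviation above |T| is impossible. *)
Lemma bern_tail (R : realType) (T : finType) (p : T -> R) (S : {set T})
    (lam : R) :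
  (forall x, 0 < p x < 1) -> 0 <= lam -> (0 < #|T|)%N ->
  \sum_(f | lam <= `|dev p f S|) bern p f
    <= 2 * expR (- (lam ^+ 2 / (8 * #|T|%:R))).
Proof.
move=> hp l0 T0; have T0' : 0 < #|T|%:R :> R by rewrite ltr0n.
have [hl|hl] := ltrP (#|T|%:R : R) lam.
  rewrite big_pred0; first by rewrite mulr_ge0 ?expR_ge0.
  move=> f; apply/negbTE; rewrite -ltNge.
  exact: le_lt_trans (dev_le_card f S hp) hl.
(* the minimizer of 2 t^2 |T| - t lam *)
pose t := lam / (4 * #|T|%:R).
have t0 : 0 <= t by rewrite divr_ge0 // mulr_ge0.
have ht : t <= 1 / 2 by rewrite ler_pdivrMr; lra.
have key (u : R) : `|u| = t ->
    \sum_f bern p f * expR (u * dev p f S - t * lam)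
      <= expR (- (lam ^+ 2 / (8 * #|T|%:R))).
  move=> hu; under eq_bigr do rewrite expRD mulrA.
  rewrite -mulr_suml.
  have hu2 : `|u| <= 1 / 2 by rewrite hu.
  have := ler_wpM2r (expR_ge0 (- (t * lam))) (bern_mgf S hp hu2).
  move=> /le_trans; apply.
  rewrite -expRD ler_expR -[u ^+ 2]real_normK ?num_real // hu le_eqVlt; apply/orP; left.
  apply/eqP; rewrite /t; field; by rewrite gt_eqF.
apply: (@le_trans _ _ (\sum_f (bern p f * expR (t * dev p f S - t * lam)
     + bern p f * expR (- t * dev p f S - t * lam)))); last first.
  rewrite big_split /= mulr_natl mulr2n lerD // key // ?normrN ger0_norm //.
rewrite big_mkcond /=; apply: ler_sum => f _.
have b0 := ltW (@bern_gt0 _ _ p f hp).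
case: ifP => [|_]; last by rewrite addr_ge0 // mulr_ge0 // expR_ge0.
rewrite ler_normr -mulrDr => /orP hd; rewrite ler_peMr //.
case: hd => hd.
  apply: (@le_trans _ _ (expR (t * dev p f S - t * lam))).
    by rewrite -expR0 ler_expR -mulrBr mulr_ge0 // subr_ge0.
  by rewrite lerDl expR_ge0.
apply: (@le_trans _ _ (expR (- t * dev p f S - t * lam))).
  by rewrite -expR0 ler_expR mulNr -mulrN -mulrBr mulr_ge0 // subr_ge0.
by rewrite lerDr expR_ge0.
Qed.

Lemma bern_union_tail (R : realType) (T U : finType) (p : T -> R)
    (S : U -> {set T}) (lam : R) :
  (forall x, 0 < p x < 1) -> 0 <= lam -> (0 < #|T|)%N ->
  \sum_(f | [exists u, lam <= `|dev p f (S u)|]) bern p f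
    <= #|U|%:R * (2 * expR (- (lam ^+ 2 / (8 * #|T|%:R)))).
Proof.
move=> hp l0 T0.
apply: (@le_trans _ _ (\sum_u \sum_(f | lam <= `|dev p f (S u)|) bern p f)).
  under [leRHS]eq_bigr do rewrite big_mkcond.
  rewrite exchange_big big_mkcond /=; apply: ler_sum => f _.
  have b0 := ltW (@bern_gt0 _ _ p f hp).
  have nn (u : U) : 0 <= (if lam <= `|dev p f (S u)| then bern p f else 0).
    by case: ifP.
  case: ifP => [/existsP[u hu]|_]; last exact: sumr_ge0.
  by rewrite (bigD1 u) //= hu lerDl sumr_ge0.
apply: (@le_trans _ _ (\sum_(u : U) 2 * expR (- (lam ^+ 2 / (8 * #|T|%:R))))).
  by apply: ler_sum => u _; exact: bern_tail.
by rewrite sumr_const -[leLHS]mulr_natl lexx.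
Qed.

Definition hamming (T : finType) (f g : {ffun T -> bool}) : nat :=
  #|[set x | f x != g x]%SET|.

(** An element of the ball is coded by a list of L cells or blanks: the cells where
it differs from the centre. *)
Lemma card_hamming_ball (T : finType) (g : {ffun T -> bool}) (L : nat) :
  (#|[set f | (hamming f g <= L)%N]%SET| <= #|T|.+1 ^ L)%N.
Proof.
pose F (h : {ffun 'I_L -> option T}) : {ffun T -> bool} :=
  [ffun x => g x (+) [exists i, h i == Some x]].
have -> : (#|T|.+1 ^ L = #|{ffun 'I_L -> option T}|)%N.
  by rewrite card_ffun card_option card_ord.
rewrite -cardsT; apply: leq_trans (leq_imset_card F _).
apply: subset_leq_card; apply/fintype.subsetP => f; rewrite inE /hamming.
set D := [set x | _]%SET => hD; apply/imsetP.
exists [ffun i : 'I_L => nth None (map Some (enum D)) i]; first by rewrite inE.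
(* the entries of the code beyond the differing cells are blanks *)
apply/ffunP => x; rewrite ffunE.
have -> : [exists i : 'I_L,
    [ffun i : 'I_L => nth None (map Some (enum D)) i] i == Some x] = (x \in D).
  apply/existsP/idP => [[i]|xD].
    rewrite ffunE; case: (ltnP i (size (enum D))) => hi.
      rewrite (nth_map x) // => /eqP[<-].
      by have := mem_nth x hi; rewrite mem_enum.
    by rewrite nth_default ?size_map.
  have xi : (index x (enum D) < size (enum D))%N.
    by rewrite index_mem mem_enum.
  have xL : (index x (enum D) < L)%N.
    by apply: leq_trans xi _; rewrite -cardE.
  exists (Ordinal xL); rewrite ffunE /= (nth_map x) // nth_index //.
  by rewrite mem_enum.
by rewrite inE; case: (f x); case: (g x).
Qed.

Lemma bern_hamming (R : realType) (T : finType) (p : T -> R) (c0 : R)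
    (f g : {ffun T -> bool}) :
  0 < c0 -> (forall x, c0 <= p x <= 1 - c0) ->
  bern p f <= c0^-1 ^+ hamming f g * bern p g.
Proof.
move=> c00 hp.
have -> : c0^-1 ^+ hamming f g =
    \prod_x (if f x != g x then c0^-1 else 1).
  rewrite -big_mkcond /= prodr_const /hamming; congr (_ ^+ _).
  by apply: eq_card => x; rewrite inE.
rewrite /bern -big_split /=; apply: ler_prod => x _.
have /andP[h1 h2] := hp x.
apply/andP; split; first by case: (f x); lra.
case: eqVneq => [->|]; first by rewrite mul1r.
by case: (f x); case: (g x) => //= _; rewrite mulrC ler_pdivlMr //; nra.
Qed.

(** Each change of an entry multiplies the weight by at most 1 / c0, and there are
at most |T| + 1 choices for each of the L changes. *)
Lemma bern_ball (R : realType) (T : finType) (p : T -> R) (c0 : R)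
    (g : {ffun T -> bool}) (L : nat) :
  0 < c0 <= 1 -> (forall x, c0 <= p x <= 1 - c0) ->
  \sum_(f | (hamming f g <= L)%N) bern p f
    <= (c0^-1 * #|T|.+1%:R) ^+ L * bern p g.
Proof.
move=> /andP[c00 c01] hp.
have hp' x : 0 < p x < 1 by have := hp x; lra.
have hg := ltW (@bern_gt0 _ _ p g hp').
have c1 : 1 <= c0^-1 by rewrite invr_ge1 // unitf_gt0.
apply: (@le_trans _ _ (\sum_(f | (hamming f g <= L)%N) (c0^-1 ^+ L * bern p g))).
  apply: ler_sum => f hf; apply: le_trans (bern_hamming f g c00 hp) _.
  by apply: ler_wpM2r => //; rewrite ler_weXn2l.
rewrite sumr_const -[leLHS]mulr_natl exprMn mulrA [X in X * _]mulrC.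
apply: ler_wpM2r => //; apply: ler_wpM2l.
  by rewrite exprn_ge0 // invr_ge0 ltW.
rewrite -natrX ler_nat; apply: leq_trans (card_hamming_ball g L).
by apply: subset_leq_card; apply/fintype.subsetP => f; rewrite !inE.
Qed.

(** * Repairing the margins of a matrix *)

Definition rowsum (N : nat) (f : {ffun 'I_N * 'I_N -> bool}) (i : 'I_N) : nat :=
  (\sum_j f (i, j))%N.

Definition colsum (N : nat) (f : {ffun 'I_N * 'I_N -> bool}) (j : 'I_N) : nat :=
  (\sum_i f (i, j))%N.

Definition flip (T : finType) (f : {ffun T -> bool}) (x : T) :
  {ffun T -> bool} := [ffun y => f y (+) (y == x)].

Lemma hamming_flip (T : finType) (f g : {ffun T -> bool}) (x : T) :
  (hamming (flip f x) g <= (hamming f g).+1)%N.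
Proof.
rewrite /hamming.
apply: (@leq_trans #|(x |: [set y | f y != g y])%SET|).
  apply: subset_leq_card; apply/fintype.subsetP => y.
  by rewrite !inE ffunE; case: (eqVneq y x) => //= _; rewrite addbF.
by rewrite cardsU1 -add1n leq_add2r leq_b1.
Qed.

Lemma sum_flip_up (N : nat) (a b : 'I_N -> bool) (k : 'I_N) :
  ~~ a k -> (forall j, b j = a j (+) (j == k)) ->
  (\sum_j b j = (\sum_j a j).+1)%N.
Proof.
move=> ak hb; rewrite (bigD1 k) //= [in RHS](bigD1 k) //= hb eqxx (negbTE ak).
rewrite add0n add1n; congr _.+1; apply: eq_bigr => j jk.
by rewrite hb (negbTE jk) addbF.
Qed.

Lemma rowsum_flip_up (N : nat) (f : {ffun 'I_N * 'I_N -> bool}) i j k :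
  ~~ f (i, j) -> rowsum (flip f (i, j)) k = (rowsum f k + (k == i))%N.
Proof.
move=> fij; rewrite /rowsum; case: eqVneq => [->|ki].
  rewrite addn1; apply: (@sum_flip_up _ (fun b => f (i, b)) _ j fij) => b.
  by rewrite ffunE xpair_eqE eqxx.
rewrite addn0; apply: eq_bigr => b _.
by rewrite ffunE xpair_eqE (negbTE ki) addbF.
Qed.

Lemma colsum_flip_up (N : nat) (f : {ffun 'I_N * 'I_N -> bool}) i j k :
  ~~ f (i, j) -> colsum (flip f (i, j)) k = (colsum f k + (k == j))%N.
Proof.
move=> fij; rewrite /colsum; case: eqVneq => [->|kj].
  rewrite addn1; apply: (@sum_flip_up _ (fun b => f (b, j)) _ i fij) => b.
  by rewrite ffunE xpair_eqE eqxx andbT.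
rewrite addn0; apply: eq_bigr => b _.
by rewrite ffunE xpair_eqE (negbTE kj) andbF addbF.
Qed.

Lemma flipK (T : finType) (f : {ffun T -> bool}) (x : T) :
  flip (flip f x) x = f.
Proof. by apply/ffunP => y; rewrite !ffunE -addbA addbb addbF. Qed.

Lemma rowsum_flip_down (N : nat) (f : {ffun 'I_N * 'I_N -> bool}) i j k :
  f (i, j) -> rowsum f k = (rowsum (flip f (i, j)) k + (k == i))%N.
Proof.
move=> fij; rewrite -[in LHS](flipK f (i, j)) rowsum_flip_up //.
by rewrite ffunE eqxx fij.
Qed.

Lemma colsum_flip_down (N : nat) (f : {ffun 'I_N * 'I_N -> bool}) i j k :
  f (i, j) -> colsum f k = (colsum (flip f (i, j)) k + (k == j))%N.
Proof.
move=> fij; rewrite -[in LHS](flipK f (i, j)) colsum_flip_up //.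
by rewrite ffunE eqxx fij.
Qed.

(** Excess costs 4 and deficit 2 per unit.  Deleting an entry from a line in excess
then pays even if it creates a deficit in the crossing line and lengthens the list
of changes by one (4 > 2 + 1), and adding one unit to a deficient row and a
deficient column pays even if it takes three changes (2 + 2 > 3). *)
Definition penalty (N : nat) (u r : 'I_N -> nat) : nat :=
  (\sum_k (4 * (u k - r k) + 2 * (r k - u k)))%N.

Lemma penalty_unit (N : nat) (u v r : 'I_N -> nat) (i : 'I_N) :
  (forall k, v k = (u k + (k == i))%N) ->
  (penalty v r + (4 * (u i - r i) + 2 * (r i - u i)) =
   penalty u r + (4 * ((u i).+1 - r i) + 2 * (r i - (u i).+1)))%N.
Proof.
move=> hv; rewrite /penalty (bigD1 i) //= [in RHS](bigD1 i) //= hv eqxx addn1.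
rewrite (eq_bigr (fun k => 4 * (u k - r k) + 2 * (r k - u k))%N); first lia.
by move=> k ki; rewrite hv (negbTE ki) addn0.
Qed.

Lemma penalty_incr (N : nat) (u v r : 'I_N -> nat) (i : 'I_N) :
  (forall k, v k = (u k + (k == i))%N) -> (u i < r i)%N ->
  (penalty v r + 2 <= penalty u r)%N.
Proof. by move=> /(penalty_unit r); lia. Qed.

Lemma penalty_decr (N : nat) (u v r : 'I_N -> nat) (i : 'I_N) :
  (forall k, v k = (u k + (k == i))%N) -> (r i < v i)%N ->
  (penalty u r + 4 <= penalty v r)%N.
Proof.
move=> huv; have := huv i; rewrite eqxx; have := penalty_unit r huv; lia.
Qed.

Lemma penalty_decr_le (N : nat) (u v r : 'I_N -> nat) (i : 'I_N) :
  (forall k, v k = (u k + (k == i))%N) -> (penalty u r <= penalty v r + 2)%N.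
Proof. by move=> /(penalty_unit r); lia. Qed.

(** The table is a minimizer of the Hamming distance to f0 plus the penalties of
the margins.  By the choice of the penalties no line of it is in excess.  If a
line is deficient, then so are a row i and a column j, and either the entry (i, j)
can be set, or a detour through the three cells (i, j'), (i', j'), (i', j) supplied
by the third hypothesis raises row i and column j and nothing else. *)
Lemma repair_table (N : nat) (r c : 'I_N -> nat)
    (f0 : {ffun 'I_N * 'I_N -> bool}) (L : nat) :
  (\sum_i r i = \sum_j c j)%N ->
  (penalty (rowsum f0) r + penalty (colsum f0) c <= L)%N ->
  (forall (f : {ffun 'I_N * 'I_N -> bool}) i j,
     (hamming f f0 <= L)%N -> (rowsum f i < r i)%N ->
     (colsum f j < c j)%N ->
     exists i' j' : 'I_N, [&& f (i', j'), ~~ f (i, j') & ~~ f (i', j)]) ->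
  exists f, [/\ rowsum f =1 r, colsum f =1 c & (hamming f f0 <= L)%N].
Proof.
move=> hrc hL path.
pose Phi (f : {ffun 'I_N * 'I_N -> bool}) :=
  (hamming f f0 + penalty (rowsum f) r + penalty (colsum f) c)%N.
have hPhi0 : (Phi f0 <= L)%N.
  rewrite /Phi; suff -> : hamming f0 f0 = 0%N by [].
  by apply/eqP; rewrite /hamming cards_eq0; apply/eqP/setP => x; rewrite !inE eqxx.
have [f fmin] : exists f : {ffun 'I_N * 'I_N -> bool},
    forall g : {ffun 'I_N * 'I_N -> bool}, (Phi f <= Phi g)%N.
  by case: (@arg_minnP _ f0 xpredT Phi isT) => f _ h; exists f => g; exact: h.
have fL : (hamming f f0 <= L)%N.
  have := fmin f0; move: hPhi0; rewrite /Phi; lia.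
have row_le i : (rowsum f i <= r i)%N.
  rewrite leqNgt; apply/negP => hi.
  have [j fij] : exists j : 'I_N, f (i, j).
    apply/existsP; apply: contraLR hi; rewrite negb_exists => /forallP h.
    rewrite -leqNgt /rowsum big1 // => j _; by rewrite (negbTE (h j)).
  have e1 := penalty_decr (fun k => rowsum_flip_down k fij) hi.
  have e2 := penalty_decr_le c (fun k => colsum_flip_down k fij).
  have e3 := hamming_flip f f0 (i, j).
  have := fmin (flip f (i, j)); rewrite /Phi leqNgt => /negP; apply.
  move: e1 e2 e3; move: (flip f (i, j)) => g; lia.
have col_le j : (colsum f j <= c j)%N.
  rewrite leqNgt; apply/negP => hj.
  have [i fij] : exists i : 'I_N, f (i, j).
    apply/existsP; apply: contraLR hj; rewrite negb_exists => /forallP h.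
    rewrite -leqNgt /colsum big1 // => i _; by rewrite (negbTE (h i)).
  have e1 := penalty_decr_le r (fun k => rowsum_flip_down k fij).
  have e2 := penalty_decr (fun k => colsum_flip_down k fij) hj.
  have e3 := hamming_flip f f0 (i, j).
  have := fmin (flip f (i, j)); rewrite /Phi leqNgt => /negP; apply.
  move: e1 e2 e3; move: (flip f (i, j)) => g; lia.
have noboth i j : (rowsum f i < r i)%N -> (colsum f j < c j)%N -> False.
  move=> hi hj; have [i' [j' /and3P[f1 f2 f3]]] := path f i j fL hi hj.
  case fij : (f (i, j)); last first.
    have nf : ~~ f (i, j) by rewrite fij.
    have e1 := penalty_incr (fun k => rowsum_flip_up k nf) hi.
    have e2 := penalty_incr (fun k => colsum_flip_up k nf) hj.
    have e3 := hamming_flip f f0 (i, j).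
    have := fmin (flip f (i, j)); rewrite /Phi leqNgt => /negP; apply.
    move: e1 e2 e3; move: (flip f (i, j)) => g; lia.
  have ii : i' != i by apply: contraNneq f3 => ->; rewrite fij.
  have jj : j' != j by apply: contraNneq f2 => ->; rewrite fij.
  (* the detour: set (i, j'), clear (i', j'), set (i', j) *)
  pose g1 := flip f (i, j'); pose g2 := flip g1 (i', j').
  pose g3 := flip g2 (i', j).
  have g1i : g1 (i', j') by rewrite ffunE xpair_eqE (negbTE ii) f1.
  have g2i : ~~ g2 (i', j).
    by rewrite !ffunE !xpair_eqE (negbTE ii) eqxx (eq_sym j) (negbTE jj) !addbF.
  have hr k : rowsum g3 k = (rowsum f k + (k == i))%N.
    rewrite /g3 (rowsum_flip_up _ g2i) -(rowsum_flip_down _ g1i).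
    by rewrite (rowsum_flip_up _ f2).
  have hc k : colsum g3 k = (colsum f k + (k == j))%N.
    rewrite /g3 (colsum_flip_up _ g2i).
    have := colsum_flip_down k g1i; rewrite -/g2 (colsum_flip_up _ f2).
    by clear; lia.
  have e1 := penalty_incr hr hi; have e2 := penalty_incr hc hj.
  have := fmin g3; rewrite /Phi.
  have h1 : (hamming g1 f0 <= (hamming f f0).+1)%N by exact: hamming_flip.
  have h2 : (hamming g2 f0 <= (hamming g1 f0).+1)%N by exact: hamming_flip.
  have h3 : (hamming g3 f0 <= (hamming g2 f0).+1)%N by exact: hamming_flip.
  move: h1 h2 h3 e1 e2.
  move: (hamming g1 f0) (hamming g2 f0) (hamming g3 f0) (penalty (rowsum g3) r).
  by move: (penalty (colsum g3) c); lia.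
have sumE : (\sum_i rowsum f i = \sum_j colsum f j)%N by exact: exchange_big.
have lesum (u v : 'I_N -> nat) : (forall k, (u k <= v k)%N) ->
    (\sum_k u k = \sum_k v k)%N -> u =1 v.
  move=> uv e k; apply/eqP; rewrite eqn_leq uv /= leqNgt; apply/negP => hk.
  have : (\sum_(j | j != k) u j <= \sum_(j | j != k) v j)%N.
    exact: leq_sum.
  move: e; rewrite (bigD1 k) //= [in RHS](bigD1 k) //=; lia.
have sumle (u v : 'I_N -> nat) : (forall k, (u k <= v k)%N) ->
    (\sum_k u k = \sum_k v k)%N \/ exists k, (u k < v k)%N.
  move=> uv; case: (pickP (fun k => (u k < v k)%N)) => [k hk|h].
    by right; exists k.
  left; apply: eq_bigr => k _; apply/eqP; rewrite eqn_leq uv /=.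
  by rewrite leqNgt h.
exists f; have [er|[i hi]] := sumle _ _ row_le.
  split => //; first exact: lesum.
  by apply: lesum => //; rewrite -sumE er.
have [ec|[j hj]] := sumle _ _ col_le; last by case: (noboth i j).
split => //; last exact: lesum.
by apply: lesum => //; rewrite sumE ec.
Qed.

(** * Rectangle discrepancy *)

Definition large_disc (R : realType) (N : nat) (p : 'I_N * 'I_N -> R) (lam : R)
    (f : {ffun 'I_N * 'I_N -> bool}) : bool :=
  [exists u : {set 'I_N} * {set 'I_N}, lam <= `|dev p f (finset.setX u.1 u.2)|].

Lemma bern_large_disc (R : realType) (N : nat) (p : 'I_N * 'I_N -> R) (lam : R) :
  (0 < N)%N -> (forall x, 0 < p x < 1) -> 0 <= lam ->
  \sum_(f | large_disc p lam f) bern p f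
    <= 4 ^+ N * (2 * expR (- (lam ^+ 2 / (8 * N%:R ^+ 2)))).
Proof.
move=> N0 hp l0.
have := bern_union_tail (fun u : {set 'I_N} * {set 'I_N} => finset.setX u.1 u.2) hp l0.
rewrite !card_prod !card_ord muln_gt0 N0 => /(_ isT).
have -> : #|{set 'I_N}| = (2 ^ N)%N.
  by rewrite -cardsT -powersetT card_powerset cardsT card_ord.
by rewrite -expnMn natrX [(N * N)%:R]natrM expr2.
Qed.

(** The Chernoff exponent is 9 N / 2 here, which beats the 4^N rectangles. *)
Lemma bern_small_disc (R : realType) (N : nat) (p : 'I_N * 'I_N -> R) :
  (0 < N)%N -> (forall x, 0 < p x < 1) ->
  1 / 2 <= \sum_(f | ~~ large_disc p (6 * N%:R * Num.sqrt N%:R) f) bern p f.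
Proof.
move=> N0 hp; set lam := 6 * _ * _.
have N0' : 0 < N%:R :> R by rewrite ltr0n.
have l0 : 0 <= lam by rewrite !mulr_ge0 // sqrtr_ge0.
have := bern_large_disc N0 hp l0.
have := sum_bern p; rewrite (bigID (large_disc p lam)) /=.
have -> : lam ^+ 2 / (8 * N%:R ^+ 2) = N%:R * (9 / 2).
  by rewrite /lam exprMn sqr_sqrtr ?ltW //; field; rewrite gt_eqF.
rewrite -mulrN expRM_natl mulrCA -exprMn => h1 h2.
suff : (4 * expR (- (9 / 2))) ^+ N <= 1 / 4 :> R by lra.
(* 4 e^(-9/2) <= 1/4, from e >= 2 *)
have e1 : 2 <= expR 1 :> R by have := @expR_ge1Dx R 1; lra.
have e4 : 16 <= expR (9 / 2) :> R.
  apply: (@le_trans _ _ (expR (4%:R * 1))); last by rewrite ler_expR; lra.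
  rewrite expRM_natl; have -> : 16 = 2 ^+ 4 :> R by rewrite -natrX.
  by apply: lerXn2r => //; rewrite nnegrE; lra.
have e5 : 4 * expR (- (9 / 2)) <= 1 / 4 :> R.
  have h : expR (9 / 2) * expR (- (9 / 2)) = 1 :> R by rewrite -expRD subrr expR0.
  have : 0 < expR (- (9 / 2)) :> R by exact: expR_gt0.
  nra.
case: N N0 {N0' l0 h1 h2 p hp lam} => // N _; rewrite exprS.
have g0 : 0 <= 4 * expR (- (9 / 2)) :> R by rewrite mulr_ge0 ?expR_ge0.
have : (4 * expR (- (9 / 2))) ^+ N <= 1 :> R by apply: exprn_ile1 => //; lra.
nra.
Qed.

(** Split the indices by the sign of u. *)
Lemma sum_norm_le (R : realType) (N : nat) (u : 'I_N -> R) (lam : R) :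
  (forall I : {set 'I_N}, `|\sum_(i in I) u i| <= lam) ->
  \sum_i `|u i| <= 2 * lam.
Proof.
move=> h; rewrite (bigID (fun i => 0 <= u i)) /= mulr_natl mulr2n.
have h1 := h [set i | 0 <= u i]%SET.
have h2 := h [set i | ~~ (0 <= u i)]%SET.
apply: lerD.
  apply: le_trans h1; apply: le_trans (ler_norm _).
  rewrite (eq_bigl (fun i => i \in [set i | 0 <= u i]%SET)); last first.
    by move=> i; rewrite inE.
  by apply: ler_sum => i; rewrite inE => ui; rewrite ger0_norm.
apply: le_trans h2; rewrite -normrN; apply: le_trans (ler_norm _).
rewrite -sumrN (eq_bigl (fun i => i \in [set i | ~~ (0 <= u i)]%SET)); last first.
  by move=> i; rewrite inE.
by apply: ler_sum => i; rewrite inE -ltNge => ui; rewrite ltr0_norm.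
Qed.

(** Small discrepancy on the rectangles I x [N] bounds the total deviation of all
row sums at once, which a bound for each row would not do. *)
Lemma penalty_le (R : realType) (N : nat) (u r : 'I_N -> nat) (rho : 'I_N -> R)
    (lam : R) :
  (forall I : {set 'I_N}, `|\sum_(i in I) ((u i)%:R - rho i)| <= lam) ->
  (forall i, `|rho i - (r i)%:R| <= 1) ->
  (penalty u r)%:R <= 4 * (2 * lam + N%:R).
Proof.
move=> /sum_norm_le h hr.
have h2 : \sum_(i < N) `|rho i - (r i)%:R| <= N%:R.
  apply: (@le_trans _ _ (\sum_(i < N) 1)); first exact: ler_sum.
  by rewrite sumr_const card_ord.
rewrite /penalty natr_sum.
apply: (@le_trans _ _ (\sum_(i < N) 4 * (`|(u i)%:R - rho i|
     + `|rho i - (r i)%:R|))); last first.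
  by rewrite -mulr_sumr big_split /= ler_pM2l // lerD.
apply: ler_sum => i _.
apply: (@le_trans _ _ (4 * `|(u i)%:R - (r i)%:R|)); last first.
  rewrite ler_pM2l //; apply: le_trans (ler_normD _ _).
  by rewrite addrA subrK.
have [ur|/ltnW ru] := leqP (u i) (r i).
  rewrite (eqP ur) muln0 add0n distrC -natrB // ger0_norm // natrM.
  by rewrite ler_wpM2r // ler_nat.
by rewrite (eqP ru) muln0 addn0 -natrB // ger0_norm // natrM.
Qed.

Lemma dev_setX (R : realType) (N : nat) (p : 'I_N * 'I_N -> R) f (I J : {set 'I_N}) :
  dev p f (finset.setX I J) =
  \sum_(i in I) \sum_(j in J) ((f (i, j))%:R - p (i, j)).
Proof.
by rewrite pair_big /dev; apply: eq_big => [[i j]|[i j] _ //]; rewrite inE.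
Qed.

Lemma small_discP (R : realType) (N : nat) (p : 'I_N * 'I_N -> R) (lam : R) f
    (I J : {set 'I_N}) :
  ~~ large_disc p lam f ->
  `|\sum_(i in I) \sum_(j in J) ((f (i, j))%:R - p (i, j))| <= lam.
Proof.
move=> /existsPn /(_ (I, J)); rewrite -ltNge -dev_setX; exact: ltW.
Qed.

(** The detours needed by repair_table exist: the zeros of row i and of column j span
a rectangle with sides at least h, in which f0 has at least c0 h^2 - lam ones, more
than the L changes made so far can have erased. *)
Lemma table_near_small_disc (R : realType) (N : nat) (p : 'I_N * 'I_N -> R)
    (r c : 'I_N -> nat) (c0 lam : R) (h L : nat)
    (f0 : {ffun 'I_N * 'I_N -> bool}) :
  (\sum_i r i = \sum_j c j)%N -> 0 <= c0 -> (forall x, c0 <= p x) ->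
  (forall i, `|\sum_j p (i, j) - (r i)%:R| <= 1) ->
  (forall j, `|\sum_i p (i, j) - (c j)%:R| <= 1) ->
  (forall i, (r i + h <= N)%N) -> (forall j, (c j + h <= N)%N) ->
  16 * lam + 8 * N%:R <= L%:R -> lam + L%:R < c0 * h%:R ^+ 2 ->
  ~~ large_disc p lam f0 ->
  exists f, [/\ rowsum f =1 r, colsum f =1 c & (hamming f f0 <= L)%N].
Proof.
move=> hrc c00 hp pr pc hr hc hL hlam hd.
apply: repair_table => //.
  rewrite -(ler_nat R) natrD.
  have p1 : (penalty (rowsum f0) r)%:R <= 4 * (2 * lam + N%:R).
    apply: penalty_le pr => I.
    have := small_discP I [set: 'I_N]%SET hd.
    congr (`|_| <= _); apply: eq_bigr => i _.
    rewrite sumrB /rowsum natr_sum; congr (_ - _); apply: eq_bigl => j;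
      by rewrite inE.
  have p2 : (penalty (colsum f0) c)%:R <= 4 * (2 * lam + N%:R).
    apply: penalty_le pc => J.
    have := small_discP [set: 'I_N]%SET J hd; rewrite exchange_big /=.
    congr (`|_| <= _); apply: eq_bigr => j _.
    rewrite sumrB /colsum natr_sum; congr (_ - _); apply: eq_bigl => i;
      by rewrite inE.
  lra.
move=> f i j hf hi hj.
pose J := [set j' | ~~ f (i, j')]%SET; pose I := [set i' | ~~ f (i', j)]%SET.
have card0 (a : 'I_N -> bool) :
    (\sum_k a k + #|[set k | ~~ a k]%SET| = N)%N.
  rewrite -sum1_card [X in (_ + X)%N]big_mkcond -big_split /=.
  rewrite -[RHS]card_ord -sum1_card; apply: eq_bigr => k _.
  by rewrite inE; case: (a k).
have hJ : (h <= #|J|)%N.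
  have := card0 (fun j' => f (i, j')); rewrite -/J -/(rowsum f i).
  have := hr i; lia.
have hI : (h <= #|I|)%N.
  have := card0 (fun i' => f (i', j)); rewrite -/I -/(colsum f j).
  have := hc j; lia.
case: (pickP [pred u : 'I_N * 'I_N | (u \in finset.setX I J) && f u]) => [[a b]|none].
  rewrite /= !inE /= -andbA => /and3P[h1 h2 h3]; exists a, b.
  by rewrite h1 h2 h3.
(* otherwise every one of f0 in I x J has been erased *)
exfalso; have := small_discP I J hd; apply/negP; rewrite -ltNge.
rewrite -dev_setX -normrN; apply: lt_le_trans (ler_norm _).
rewrite /dev sumrB.
have q1 : \sum_(x in finset.setX I J) (f0 x)%:R <= L%:R :> R.
  rewrite -natr_sum ler_nat; apply: leq_trans hf.
  rewrite /hamming -sum1_card big_mkcond [leqRHS]big_mkcond /=.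
  apply: leq_sum => x _; rewrite !inE; have := none x; rewrite /= !inE.
  by case: ifP => //= _ ->; case: (f0 x).
have q2 : c0 * h%:R ^+ 2 <= \sum_(x in finset.setX I J) p x.
  apply: (@le_trans _ _ (\sum_(x in finset.setX I J) c0)); last by apply: ler_sum.
  rewrite sumr_const cardsX -[leRHS]mulr_natr ler_wpM2l //.
  by rewrite -natrX ler_nat -mulnn leq_mul.
lra.
Qed.

(** * Comparing the uniform table with Bernoulli entries *)

Definition with_margins (N : nat) (r c : 'I_N -> nat) :
    {set {ffun 'I_N * 'I_N -> bool}} :=
  [set f | [forall i, rowsum f i == r i] && [forall j, colsum f j == c j]]%SET.

Lemma hammingC (T : finType) (f g : {ffun T -> bool}) :
  hamming f g = hamming g f.
Proof. by apply: eq_card => x; rewrite !inE eq_sym. Qed.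

(** At least half of the Bernoulli mass lies within distance L of a table, so the
balls of radius L about the tables carry mass 1/2. *)
Lemma bern_with_margins (R : realType) (N : nat) (p : 'I_N * 'I_N -> R)
    (r c : 'I_N -> nat) (c0 : R) (h L : nat) (lam := 6 * N%:R * Num.sqrt N%:R) :
  (0 < N)%N -> (\sum_i r i = \sum_j c j)%N ->
  0 < c0 -> (forall x, c0 <= p x <= 1 - c0) ->
  (forall i, `|\sum_j p (i, j) - (r i)%:R| <= 1) ->
  (forall j, `|\sum_i p (i, j) - (c j)%:R| <= 1) ->
  (forall i, (r i + h <= N)%N) -> (forall j, (c j + h <= N)%N) ->
  16 * lam + 8 * N%:R <= L%:R -> lam + L%:R < c0 * h%:R ^+ 2 ->
  1 / 2 <= (c0^-1 * ((N * N).+1)%:R) ^+ L *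
             \sum_(f in with_margins r c) bern p f.
Proof.
move=> N0 hrc c00 hp pr pc hr hc hL hlam.
have hp' x : 0 < p x < 1 by have := hp x; lra.
have c01 : 0 < c0 <= 1.
  by rewrite c00 /=; have := hp (Ordinal N0, Ordinal N0); lra.
apply: le_trans (bern_small_disc N0 hp') _; rewrite -/lam.
apply: (@le_trans _ _ (\sum_(f in with_margins r c)
    \sum_(f0 | (hamming f0 f <= L)%N) bern p f0)).
  under [leRHS]eq_bigr do rewrite big_mkcond.
  rewrite exchange_big big_mkcond /=; apply: ler_sum => f0 _.
  have nn (f : {ffun 'I_N * 'I_N -> bool}) :
      0 <= (if (hamming f0 f <= L)%N then bern p f0 else 0).
    by case: ifP => // _; exact/ltW/bern_gt0.
  case: ifP => [hd|_]; last exact: sumr_ge0.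
  have [|f [fr fc fL]] := @table_near_small_disc _ _ p r c c0 lam h L f0 hrc
      (ltW c00) _ pr pc hr hc hL hlam hd.
    by move=> x; case/andP: (hp x).
  have fM : f \in with_margins r c.
    rewrite inE; apply/andP; split; apply/forallP => i; apply/eqP; auto.
  by rewrite (bigD1 f) //= hammingC fL lerDl sumr_ge0.
rewrite mulr_sumr; apply: ler_sum => f _.
have := bern_ball f L c01 hp.
by rewrite card_prod card_ord.
Qed.

Lemma bern_odds (R : realType) (T : finType) (p : T -> R)
    (f : {ffun T -> bool}) :
  (forall x, 0 < p x < 1) ->
  bern p f = \prod_x (1 - p x) *
             expR (\sum_x (f x)%:R * ln (p x / (1 - p x))).
Proof.
move=> hp; rewrite expR_sum -big_split /=; apply: eq_bigr => x _.
have /andP[p0 p1] := hp x; have q0 : 0 < 1 - p x by rewrite subr_gt0.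
case: (f x) => /=; last by rewrite mul0r expR0 mulr1.
by rewrite mul1r lnK ?posrE ?divr_gt0 // mulrC divfK // gt_eqF.
Qed.

(** The log weight is linear in the entries with the log odds as coefficients, and the
additive part a_i + b_j of the odds only sees the margins. *)
Lemma bern_ratio (R : realType) (N : nat) (p : 'I_N * 'I_N -> R)
    (r c : 'I_N -> nat) (a b : 'I_N -> R) (gam : R) (Z : {set 'I_N * 'I_N})
    (f g : {ffun 'I_N * 'I_N -> bool}) :
  (forall x, 0 < p x < 1) ->
  (forall i j, ln (p (i, j) / (1 - p (i, j))) =
               a i + b j + gam * ((i, j) \in Z)%:R) ->
  f \in with_margins r c -> g \in with_margins r c ->
  bern p f <= expR (`|gam| * #|Z|%:R) * bern p g.
Proof.
move=> hp hl fM gM; rewrite !bern_odds // mulrCA.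
apply: ler_wpM2l.
  by apply: prodr_ge0 => x _; have := hp x; lra.
rewrite -expRD ler_expR -lerBlDr.
have S (k : {ffun 'I_N * 'I_N -> bool}) : k \in with_margins r c ->
    \sum_x (k x)%:R * ln (p x / (1 - p x)) =
    \sum_i a i * (r i)%:R + \sum_j b j * (c j)%:R
      + gam * \sum_(x in Z) (k x)%:R.
  rewrite inE => /andP[/forallP kr /forallP kc].
  have -> : \sum_i a i * (r i)%:R = \sum_i \sum_j a i * (k (i, j))%:R.
    apply: eq_bigr => i _; rewrite -mulr_sumr -(eqP (kr i)) /rowsum.
    by rewrite natr_sum.
  have -> : \sum_j b j * (c j)%:R = \sum_i \sum_j b j * (k (i, j))%:R.
    rewrite exchange_big; apply: eq_bigr => j _.
    by rewrite -mulr_sumr -(eqP (kc j)) /colsum natr_sum.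
  rewrite !pair_big /= mulr_sumr [X in _ + _ + X]big_mkcond -!big_split /=.
  apply: eq_bigr => [[i j]] _; rewrite hl /=; case: ifP => _ /=; ring.
rewrite (S f fM) (S g gM).
set A := \sum_i _; set B := \sum_j _.
have -> : A + B + gam * \sum_(x in Z) (f x)%:R
    - (A + B + gam * \sum_(x in Z) (g x)%:R) =
  gam * \sum_(x in Z) ((f x)%:R - (g x)%:R) by rewrite sumrB; ring.
apply: le_trans (ler_norm _) _; rewrite normrM ler_wpM2l //.
apply: le_trans (ler_norm_sum _ _ _) _.
rewrite -sum1_card natr_sum; apply: ler_sum => x _.
by case: (f x); case: (g x); rewrite ?subrr ?subr0 ?sub0r ?normrN ?normr0 ?normr1.
Qed.

(** Compare both sides with the double sum over bad tables f and tables g of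
W * bern f. *)
Lemma uniform_le_bern (R : realType) (N : nat) (p : 'I_N * 'I_N -> R)
    (M : {set {ffun 'I_N * 'I_N -> bool}}) (W : R)
    (bad : pred {ffun 'I_N * 'I_N -> bool}) :
  (forall x, 0 < p x < 1) -> 0 <= W ->
  {in M &, forall f g, bern p f <= W * bern p g} ->
  #|[set f in M | bad f]%SET|%:R * \sum_(f in M) bern p f
    <= #|M|%:R * (W * \sum_(f | bad f) bern p f).
Proof.
move=> hp W0 hW; set B := [set f in M | bad f]%SET.
apply: (@le_trans _ _ (\sum_(f in B) \sum_(g in M) W * bern p f)).
  rewrite -sum1_card natr_sum mulr_suml; apply: ler_sum => f.
  rewrite inE => /andP[fM _]; rewrite mul1r; apply: ler_sum => g gM.
  exact: hW.
rewrite (eq_bigr (fun f => #|M|%:R * (W * bern p f))); last first.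
  by move=> f _; rewrite sumr_const mulr_natl.
rewrite -!mulr_sumr !ler_wpM2l //.
rewrite [leLHS]big_mkcond [leRHS]big_mkcond /=; apply: ler_sum => f _.
have h := ltW (@bern_gt0 _ _ p f hp).
by rewrite inE; case: (f \in M); case: (bad f).
Qed.

Definition block_prob (R : realType) (m n : nat) (p1 p2 p3 : R)
    (x : 'I_(m + n) * 'I_(m + n)) : R :=
  if (x.1 < m)%N then (if (x.2 < m)%N then p1 else p2)
  else (if (x.2 < m)%N then p2 else p3).

Definition block_margin (m n s t : nat) (i : 'I_(m + n)) : nat :=
  if (i < m)%N then s else t.

Lemma sum_block (V : nmodType) (m n : nat) (F : 'I_(m + n) -> V) (x y : V) :
  (forall i : 'I_(m + n), F i = if (i < m)%N then x else y) ->
  \sum_i F i = x *+ m + y *+ n.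
Proof.
move=> hF; rewrite big_split_ord /=; congr (_ + _).
  rewrite (eq_bigr (fun=> x)) ?sumr_const ?card_ord // => i _.
  by rewrite hF /= ltn_ord.
rewrite (eq_bigr (fun=> y)) ?sumr_const ?card_ord // => i _.
by rewrite hF /= ltnNge leq_addr.
Qed.

Lemma ln_odds_le (R : realType) (c0 p : R) : 0 < c0 -> c0 <= p <= 1 - c0 ->
  `|ln (p / (1 - p))| <= - ln c0.
Proof.
move=> c00 /andP[p0 p1].
have q0 : 0 < 1 - p by lra.
have pp : 0 < p by lra.
rewrite ler_norml opprK; apply/andP; split.
  rewrite ler_ln ?posrE ?divr_gt0 // ler_pdivlMr //; nra.
rewrite -lnV ?posrE // ler_ln ?posrE ?divr_gt0 ?invr_gt0 //.
by rewrite ler_pdivrMr // mulrC ler_pdivlMr //; nra.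
Qed.

(** The block probabilities make all expected margins correct up to rounding; only on
the heavy block, of m^2 cells, do their log odds fail to be additive.  The factors of
the bound are the inverse mass of the tables, the oscillation of the weight on them,
and the Chernoff bound for all rectangles. *)
Lemma uniform_large_disc (R : realType) (m n s t h L : nat)
    (p1 p2 p3 c0 lam : R) (N := (m + n)%N)
    (p := @block_prob R m n p1 p2 p3)
    (M := with_margins (@block_margin m n s t) (@block_margin m n s t)) :
  (0 < n)%N -> 0 < c0 ->
  c0 <= p1 <= 1 - c0 -> c0 <= p2 <= 1 - c0 -> c0 <= p3 <= 1 - c0 ->
  `|m%:R * p1 + n%:R * p2 - s%:R| <= 1 ->
  `|m%:R * p2 + n%:R * p3 - t%:R| <= 1 ->
  (s + h <= N)%N -> (t + h <= N)%N ->
  96 * (N%:R * Num.sqrt N%:R) + 8 * N%:R <= L%:R :> R ->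
  6 * (N%:R * Num.sqrt N%:R) + L%:R < c0 * h%:R ^+ 2 -> 0 <= lam ->
  (#|[set f in M | large_disc p lam f]%SET|%:R : R) <=
  #|M|%:R * ((2 * (c0^-1 * ((N * N).+1)%:R) ^+ L) *
    (expR (- ln c0 * 4 * m%:R ^+ 2) *
     (4 ^+ N * (2 * expR (- (lam ^+ 2 / (8 * N%:R ^+ 2))))))).
Proof.
move=> n0 c00 hp1 hp2 hp3 hs ht hsh hth hL hlam l0.
have N0 : (0 < N)%N by rewrite addn_gt0 n0 orbT.
have hp x : c0 <= p x <= 1 - c0.
  by rewrite /p /block_prob; case: ifP => _; case: ifP.
have hp' x : 0 < p x < 1 by have := hp x; lra.
have pr (i : 'I_N) : `|\sum_j p (i, j) - (@block_margin m n s t i)%:R| <= 1.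
  rewrite /p /block_prob /block_margin /=; case: ifP => im.
    by rewrite (@sum_block _ m n _ p1 p2) // -[p1 *+ m]mulr_natl -[p2 *+ n]mulr_natl.
  by rewrite (@sum_block _ m n _ p2 p3) // -[p2 *+ m]mulr_natl -[p3 *+ n]mulr_natl.
have pc (j : 'I_N) : `|\sum_i p (i, j) - (@block_margin m n s t j)%:R| <= 1.
  rewrite /p /block_prob /block_margin /=; case: ifP => jm.
    by rewrite (@sum_block _ m n _ p1 p2) // -[p1 *+ m]mulr_natl -[p2 *+ n]mulr_natl.
  by rewrite (@sum_block _ m n _ p2 p3) // -[p2 *+ m]mulr_natl -[p3 *+ n]mulr_natl.
have hr (i : 'I_N) : (@block_margin m n s t i + h <= N)%N.
  by rewrite /block_margin; case: ifP.
have hmass : 1 / 2 <= (c0^-1 * ((N * N).+1)%:R) ^+ L * \sum_(f in M) bern p f.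
  apply: (@bern_with_margins R N p _ _ c0 h L) => //.
    by rewrite -mulrA; apply: le_trans hL; lra.
  by rewrite -mulrA.
pose l (q : R) := ln (q / (1 - q)).
(* a_i + a_j is the log odds of (i, j) except on the heavy block Z, where the
   defect is gam *)
pose a (i : 'I_N) := if (i < m)%N then l p2 - l p3 / 2 else l p3 / 2.
pose Z := [set x : 'I_N * 'I_N | (x.1 < m)%N && (x.2 < m)%N]%SET.
have cZ : #|Z| = (m * m)%N.
  rewrite (_ : Z = finset.setX [set i : 'I_N | (i < m)%N]%SET
                               [set i : 'I_N | (i < m)%N]%SET).
    have cI : #|[set i : 'I_N | (i < m)%N]%SET| = m.
      rewrite -sum1_card big_mkcond /=.
      rewrite (@sum_block nat m n _ 1%N 0%N); last by move=> i; rewrite inE.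
      by rewrite mul0rn addr0; exact: natn.
    by rewrite cardsX cI.
  by apply/setP => x; rewrite !inE.
pose gam := l p1 - 2 * l p2 + l p3.
have hgam : `|gam| <= - ln c0 * 4.
  have := ln_odds_le c00 hp1; have := ln_odds_le c00 hp2.
  have := ln_odds_le c00 hp3; rewrite -/(l p1) -/(l p2) -/(l p3) /gam.
  rewrite !ler_norml => /andP[g1 g2] /andP[g3 g4] /andP[g5 g6].
  by clear -g1 g2 g3 g4 g5 g6; apply/andP; split; lra.
have hW f g : f \in M -> g \in M ->
    bern p f <= expR (- ln c0 * 4 * m%:R ^+ 2) * bern p g.
  move=> fM gM; apply: le_trans (bern_ratio (a := a) (b := a) (gam := gam)
    (Z := Z) hp' _ fM gM) _.
    move=> i j; rewrite inE /a /gam /p /block_prob /=.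
    by case: ifP => _; case: ifP => _; rewrite /l /=; field.
  apply: ler_wpM2r; first exact/ltW/bern_gt0.
  by rewrite ler_expR cZ natrM -expr2 ler_wpM2r // sqr_ge0.
have hU := uniform_le_bern (large_disc p lam) hp' (expR_ge0 _) hW.
have hB := bern_large_disc N0 hp' l0.
set K := (c0^-1 * _) ^+ L in hmass *.
have K0 : 0 <= K by rewrite exprn_ge0 // mulr_ge0 // invr_ge0 ltW.
set b := #|_|%:R in hU *; set mu := \sum_(f in M) _ in hU hmass.
set W := expR _ in hU *.
have {hU} hU : b * mu <= #|M|%:R * (W * (4 ^+ N *
    (2 * expR (- (lam ^+ 2 / (8 * N%:R ^+ 2)))))).
  by apply: le_trans hU _; rewrite ler_wpM2l // ler_wpM2l // expR_ge0.
set V := W * _ in hU *.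
have b0 : 0 <= b by rewrite ler0n.
apply: (@le_trans _ _ (2 * K * (b * mu))).
  rewrite (_ : 2 * K * (b * mu) = b * (2 * (K * mu))); last by ring.
  by rewrite ler_peMr //; clear -hmass; lra.
apply: le_trans (ler_wpM2l _ hU) _; first by rewrite mulr_ge0.
by rewrite mulrCA.
Qed.

(** * Symmetries of the set of tables *)

Definition swap_square (N : nat) (i i' j j' : 'I_N)
    (f : {ffun 'I_N * 'I_N -> bool}) : {ffun 'I_N * 'I_N -> bool} :=
  flip (flip (flip (flip f (i, j)) (i, j')) (i', j)) (i', j').

Lemma swap_squareE (N : nat) (i i' j j' : 'I_N) f x :
  swap_square i i' j j' f x =
  f x (+) (x == (i, j)) (+) (x == (i, j')) (+) (x == (i', j))
      (+) (x == (i', j')).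
Proof. by rewrite !ffunE. Qed.

Lemma swap_squareK (N : nat) (i i' j j' : 'I_N) :
  involutive (swap_square i i' j j').
Proof.
move=> f; apply/ffunP => x; rewrite !swap_squareE.
by case: (f x); do 4![case: (x == _)].
Qed.

Lemma swap_square_margins (N : nat) (i i' j j' : 'I_N)
    (f : {ffun 'I_N * 'I_N -> bool}) :
  i != i' -> j != j' ->
  ~~ f (i, j) -> f (i, j') -> f (i', j) -> ~~ f (i', j') ->
  rowsum (swap_square i i' j j' f) =1 rowsum f /\
  colsum (swap_square i i' j j' f) =1 colsum f.
Proof.
move=> ii jj f1 f2 f3 f4; rewrite /swap_square.
set g1 := flip f (i, j); set g2 := flip g1 (i, j'); set g3 := flip g2 (i', j).
have e1 : g1 (i, j') by rewrite ffunE f2 xpair_eqE eqxx eq_sym (negbTE jj).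
have e2 : g2 (i', j).
  by rewrite !ffunE f3 !xpair_eqE !(eq_sym i') (negbTE ii).
have e3 : ~~ g3 (i', j').
  rewrite !ffunE !xpair_eqE eqxx !(eq_sym i') (negbTE ii) (eq_sym j').
  by rewrite (negbTE jj) !andbF /= !addbF.
split=> k.
  rewrite (rowsum_flip_up k e3) /g3 -(rowsum_flip_down k e2).
  have := rowsum_flip_down k e1; rewrite -/g2 /g1 (rowsum_flip_up k f1).
  by move=> /addIn.
have h1 := colsum_flip_up k f1; have h2 := colsum_flip_down k e1.
have h3 := colsum_flip_down k e2; have h4 := colsum_flip_up k e3.
move: h1 h2 h3 h4; rewrite -/g1 -/g2 -/g3.
move: (colsum g1 k) (colsum g2 k) (colsum g3 k) (colsum (flip g3 _) k).
by move: (colsum f k) (k == j : nat) (k == j' : nat); clear; lia.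
Qed.

Lemma mem_with_margins (N : nat) (r c : 'I_N -> nat)
    (f g : {ffun 'I_N * 'I_N -> bool}) :
  rowsum f =1 rowsum g -> colsum f =1 colsum g ->
  (f \in with_margins r c) = (g \in with_margins r c).
Proof.
move=> hr hc; rewrite !inE; congr (_ && _); apply: eq_forallb => k.
  by rewrite hr.
by rewrite hc.
Qed.

(** swap_square is an involution that preserves the margins on either pattern and
exchanges the two patterns. *)
Lemma switching_identity (R : realType) (N : nat) (r c : 'I_N -> nat)
    (i i' j j' : 'I_N) :
  i != i' -> j != j' ->
  \sum_(f in with_margins r c)
     ([&& f (i, j), ~~ f (i, j'), ~~ f (i', j) & f (i', j')])%:R =
  \sum_(f in with_margins r c)
     ([&& ~~ f (i, j), f (i, j'), f (i', j) & ~~ f (i', j')])%:R :> R.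
Proof.
move=> ii jj.
rewrite (reindex_inj (inv_inj (swap_squareK i i' j j'))) /=.
rewrite big_mkcond [RHS]big_mkcond /=; apply: eq_bigr => f _.
have ii' := ii; have jj' := jj; rewrite eq_sym in ii'; rewrite eq_sym in jj'.
rewrite !swap_squareE !xpair_eqE !eqxx (negbTE ii) (negbTE jj).
rewrite (negbTE ii') (negbTE jj') /= !addbF !addbT negbK.
case: (boolP [&& ~~ f (i, j), f (i, j'), f (i', j) & ~~ f (i', j')]).
  move=> /and4P[f1 f2 f3 f4].
  have [hr hc] := swap_square_margins ii jj f1 f2 f3 f4.
  by rewrite (mem_with_margins _ _ hr hc) f1 f2 f3 f4.
by rewrite !negbK => /negbTE ->; rewrite !if_same.
Qed.

Definition permute_cols (N : nat) (j j' : 'I_N)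
    (f : {ffun 'I_N * 'I_N -> bool}) : {ffun 'I_N * 'I_N -> bool} :=
  [ffun x => f (x.1, tperm j j' x.2)].

Lemma column_exchange (R : realType) (N : nat) (r c : 'I_N -> nat)
    (i j j' : 'I_N) : c j = c j' ->
  \sum_(f in with_margins r c) (f (i, j))%:R =
  \sum_(f in with_margins r c) (f (i, j'))%:R :> R.
Proof.
move=> cjj.
have inv : involutive (@permute_cols N j j').
  by move=> f; apply/ffunP => [[a b]]; rewrite !ffunE /= tpermK.
rewrite (reindex_inj (inv_inj inv)) /=.
apply: eq_big => [f|f _]; last by rewrite ffunE /= tpermL.
rewrite !inE; congr (_ && _).
  apply: eq_forallb => k; congr (_ == _); rewrite /rowsum.
  rewrite [RHS](reindex_inj (@perm_inj _ (tperm j j'))) /=.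
  by apply: eq_bigr => b _; rewrite ffunE.
have hc k : c (tperm j j' k) = c k by case: tpermP => // ->.
have hcol k : colsum (permute_cols j j' f) k = colsum f (tperm j j' k).
  by apply: eq_bigr => b _; rewrite ffunE.
apply/forallP/forallP => h k.
  by have := h (tperm j j' k); rewrite hcol hc tpermK.
by rewrite hcol -(hc k).
Qed.

(** Average the line sum of i over all tables: the n light columns contribute equally by
column_exchange and the m heavy ones at most 1 each. *)
Lemma mean_bottom_column (R : realType) (m n s t : nat) (i j : 'I_(m + n))
    (M := with_margins (@block_margin m n s t) (@block_margin m n s t)) :
  (m <= j)%N ->
  `|n%:R * \sum_(f in M) (f (i, j))%:R
    - #|M|%:R * (@block_margin m n s t i)%:R| <= #|M|%:R * m%:R :> R.
Proof.
move=> mj; set S := \sum_(f in M) _.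
have hrow : #|M|%:R * (@block_margin m n s t i)%:R =
    \sum_b \sum_(f in M) (f (i, b))%:R :> R.
  rewrite exchange_big /= mulr_natl -sumr_const; apply: eq_bigr => f.
  rewrite inE => /andP[/forallP /(_ i) /eqP <- _]; by rewrite natr_sum.
rewrite hrow big_split_ord /= [X in _ - (_ + X)](eq_bigr (fun=> S)); last first.
  move=> b _; apply: column_exchange.
  by rewrite /block_margin /= !ltnNge leq_addr mj.
rewrite sumr_const card_ord -[S *+ n]mulr_natl opprD addrCA subrr addr0 normrN.
rewrite ger0_norm; last by apply: sumr_ge0 => b _; apply: sumr_ge0.
apply: (@le_trans _ _ (\sum_(b < m) #|M|%:R)); last first.
  by rewrite sumr_const card_ord mulr_natr.
apply: ler_sum => b _; rewrite -sum1_card natr_sum; apply: ler_sum => f _.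
by case: (f _).
Qed.

(** * The switching identity summed over the light block *)

Lemma mul_near (R : realType) (a b x k : R) (N : R) :
  0 <= b <= N -> 0 <= x <= N -> `|a - x| <= k -> `|b - x| <= k ->
  `|a * b - x ^+ 2| <= 2 * k * N.
Proof.
move=> /andP[b0 bN] /andP[x0 xN] ha hb.
have -> : a * b - x ^+ 2 = (a - x) * b + x * (b - x) by ring.
apply: le_trans (ler_normD _ _) _; rewrite !normrM (ger0_norm b0) (ger0_norm x0).
have -> : 2 * k * N = k * N + N * k by ring.
by apply: lerD; apply: ler_pM.
Qed.

Definition bottom (m n : nat) : {set 'I_(m + n)} :=
  [set i : 'I_(m + n) | (m <= i)%N]%SET.

Lemma sum_bottom (V : nmodType) (m n : nat) (x : V) :
  \sum_(i in bottom m n) x = x *+ n.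
Proof.
rewrite big_mkcond (@sum_block V m n _ 0 x) ?mul0rn ?add0r // => i.
by rewrite inE leqNgt; case: (i < m)%N.
Qed.

(** The difference of the two switching patterns, summed over the light rows and
columns: its mean over all tables vanishes. *)
Definition square_gap (R : realType) (m n : nat) (o : 'I_(m + n))
    (f : {ffun 'I_(m + n) * 'I_(m + n) -> bool}) : R :=
  \sum_(i in bottom m n) \sum_(j in bottom m n)
    (([&& f (o, o), ~~ f (o, j), ~~ f (i, o) & f (i, j)])%:R
     - ([&& ~~ f (o, o), f (o, j), f (i, o) & ~~ f (i, j)])%:R).

Lemma sum_filter (V : nmodType) (T : finType) (B : {set T}) (P : pred T)
    (F : T -> V) :
  \sum_(i in [set i in B | P i]%SET) F i =
  \sum_(i in B) (if P i then F i else 0).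
Proof.
rewrite -big_mkcondr; apply: eq_bigl => i; by rewrite inE.
Qed.

Lemma square_gapT (R : realType) (m n : nat) (o : 'I_(m + n))
    (f : {ffun 'I_(m + n) * 'I_(m + n) -> bool}) :
  f (o, o) -> square_gap R o f =
  \sum_(i in [set i in bottom m n | ~~ f (i, o)]%SET)
    \sum_(j in [set j in bottom m n | ~~ f (o, j)]%SET) (f (i, j))%:R.
Proof.
move=> foo; rewrite sum_filter; apply: eq_bigr => i _; rewrite sum_filter foo.
case: (f (i, o)) => /=.
  by rewrite big1 // => j _; rewrite andbF subrr.
by apply: eq_bigr => j _; case: (f (o, j)); rewrite subr0.
Qed.

Lemma square_gapF (R : realType) (m n : nat) (o : 'I_(m + n))
    (f : {ffun 'I_(m + n) * 'I_(m + n) -> bool}) :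
  ~~ f (o, o) -> square_gap R o f =
  - \sum_(i in [set i in bottom m n | f (i, o)]%SET)
      \sum_(j in [set j in bottom m n | f (o, j)]%SET) (1 - (f (i, j))%:R).
Proof.
move=> /negbTE foo; rewrite sum_filter -sumrN; apply: eq_bigr => i _.
rewrite sum_filter foo; case: (f (i, o)) => /=; last first.
  by rewrite oppr0 big1 // => j _; rewrite andbF subrr.
rewrite -sumrN; apply: eq_bigr => j _.
by case: (f (o, j)); case: (f (i, j)); rewrite /= ?subrr ?subr0 ?sub0r ?oppr0.
Qed.

Lemma sum_const2 (R : realType) (T : finType) (I J : {set T}) (x : R) :
  \sum_(i in I) \sum_(j in J) x = x * (#|I|%:R * #|J|%:R).
Proof. by rewrite !sumr_const -[LHS]mulr_natr -[x *+ _]mulr_natr; ring. Qed.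

Lemma card_bottom_line (m n s : nat) (a : 'I_(m + n) -> bool) :
  (\sum_i a i = s)%N ->
  [/\ (#|[set i in bottom m n | a i]%SET|
        + #|[set i in bottom m n | ~~ a i]%SET| = n)%N,
      (#|[set i in bottom m n | a i]%SET| <= s)%N &
      (s <= #|[set i in bottom m n | a i]%SET| + m)%N].
Proof.
move=> hs.
have cn : (#|[set i in bottom m n | a i]%SET|
        + #|[set i in bottom m n | ~~ a i]%SET| = n)%N.
  transitivity (#|bottom m n|).
    rewrite -(cardsID [set i | a i]%SET (bottom m n)); congr addn;
      apply: eq_card => i; rewrite !inE //.
    by rewrite andbC.
  by rewrite -sum1_card sum_bottom; exact: natn.
have cs : (#|[set i in bottom m n | a i]%SET|
        + \sum_(i | i \notin bottom m n) a i = s)%N.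
  rewrite -hs [RHS](bigID (mem (bottom m n))) /=; congr addn.
  rewrite -sum1_card (@sum_filter nat); apply: eq_bigr => i _.
  by case: (a i).
have cm : (\sum_(i | i \notin bottom m n) a i <= m)%N.
  apply: (@leq_trans (\sum_(i < m + n) (if i < m then 1 else 0)))%N.
    rewrite big_mkcond; apply: leq_sum => i _; rewrite inE /= -ltnNge.
    by case: (i < m)%N => //=; exact: leq_b1.
  rewrite (@sum_block nat m n _ 1%N 0%N) // mul0rn addr0.
  by rewrite (_ : 1%N *+ m = m) //; exact: natn.
by split=> //; rewrite -cs ?leq_addr // leq_add2l.
Qed.

(** If f (o, o) holds, the gap counts the ones of f in the rectangle of the light zeros of
column o and row o, whose sides are (1 - q) n + O(m); otherwise it counts, negatively,
the zeros of f in the rectangle of the light ones, whose sides are q n + O(m).  A small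
discrepancy determines both counts. *)
Lemma square_gap_near (R : realType) (m n s t : nat) (o : 'I_(m + n))
    (q C p1 p2 p3 lam : R) (f : {ffun 'I_(m + n) * 'I_(m + n) -> bool}) :
  (0 < m)%N -> 0 <= q <= 1 -> 0 <= C <= 1 -> `|s%:R - q * n%:R| <= 1 ->
  `|p3 - C| * n%:R <= m%:R -> (o < m)%N ->
  f \in with_margins (@block_margin m n s t) (@block_margin m n s t) ->
  ~~ large_disc (@block_prob R m n p1 p2 p3) lam f ->
  `|square_gap R o f - ((f (o, o))%:R * (C * (1 - q) ^+ 2 + (1 - C) * q ^+ 2)
     - (1 - C) * q ^+ 2) * n%:R ^+ 2| <= lam + 5 * (m%:R * n%:R).
Proof.
move=> m0 /andP[q0 q1] /andP[C0 C1] hs hp3 om fM hd.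
move: hs; rewrite ler_norml => /andP[hs1 hs2].
have near1 (x : R) : x <= s%:R -> s%:R <= x + m%:R ->
    `|x - q * n%:R| <= m%:R + 1.
  by move=> x1 x2; rewrite ler_norml; apply/andP; split; lra.
have near0 (x y : R) : x <= s%:R -> s%:R <= x + m%:R -> x + y = n%:R ->
    `|y - (1 - q) * n%:R| <= m%:R + 1.
  by move=> x1 x2 xy; rewrite ler_norml; apply/andP; split; lra.
have hq : 0 <= 1 - q <= 1 by apply/andP; split; lra.
have := fM; rewrite inE => /andP[/forallP /(_ o) /eqP fr /forallP /(_ o) /eqP fc].
rewrite /block_margin om in fr fc.
have [r1 r2 r3] := card_bottom_line fr.
have [l1 l2 l3] := card_bottom_line fc.
move: r1 r2 r3 l1 l2 l3.
set J1 := [set j in bottom m n | f (o, j)]%SET.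
set J0 := [set j in bottom m n | ~~ f (o, j)]%SET.
set I1 := [set i in bottom m n | f (i, o)]%SET.
set I0 := [set i in bottom m n | ~~ f (i, o)]%SET.
rewrite -!(ler_nat R) => /(congr1 (fun k => k%:R : R)); rewrite !natrD.
move=> r1 r2 r3 /(congr1 (fun k => k%:R : R)); rewrite !natrD => l1 l2 l3.
have m1 : 1 <= m%:R :> R by rewrite ler1n.
have n0 : 0 <= n%:R :> R by rewrite ler0n.
have qn0 : 0 <= q * n%:R by rewrite mulr_ge0.
have qn1 : q * n%:R <= n%:R by rewrite ler_piMl.
have p3E (I J : {set 'I_(m + n)}) : I \subset bottom m n -> J \subset bottom m n ->
    \sum_(i in I) \sum_(j in J) ((f (i, j))%:R - @block_prob R m n p1 p2 p3 (i, j))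
    = \sum_(i in I) \sum_(j in J) (f (i, j))%:R - p3 * (#|I|%:R * #|J|%:R).
  move=> /fintype.subsetP hI /fintype.subsetP hJ.
  have -> : p3 * (#|I|%:R * #|J|%:R) = \sum_(i in I) \sum_(j in J) p3.
    by rewrite sum_const2.
  rewrite -sumrB; apply: eq_bigr => i /hI iB.
  rewrite -sumrB; apply: eq_bigr => j /hJ jB.
  move: iB jB; rewrite !inE /block_prob /= => iB jB.
  by rewrite ltnNge iB /= ltnNge jB.
have sub (P : pred 'I_(m + n)) : [set i in bottom m n | P i]%SET \subset bottom m n.
  by apply/fintype.subsetP => i; rewrite !inE => /andP[].
(* used with al = 1 - q for the light zeros and al = q for the light ones *)
have main (I J : {set 'I_(m + n)}) (al : R) : I \subset bottom m n ->
    J \subset bottom m n -> 0 <= al <= 1 -> #|I|%:R <= n%:R :> R ->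
    #|J|%:R <= n%:R :> R ->
    `|#|I|%:R - al * n%:R| <= m%:R + 1 -> `|#|J|%:R - al * n%:R| <= m%:R + 1 ->
    [/\ `|\sum_(i in I) \sum_(j in J) (f (i, j))%:R - p3 * (#|I|%:R * #|J|%:R)| <= lam,
     `|p3 * (#|I|%:R * #|J|%:R) - C * (#|I|%:R * #|J|%:R)| <= m%:R * n%:R &
     `|#|I|%:R * #|J|%:R - (al * n%:R) ^+ 2| <= 4 * (m%:R * n%:R)].
  move=> hI hJ /andP[al0 al1] In Jn hI2 hJ2; split.
  - by have := small_discP I J hd; rewrite p3E.
  - rewrite -mulrBl normrM (ger0_norm (mulr_ge0 _ _)) //.
    apply: (@le_trans _ _ (`|p3 - C| * n%:R * n%:R)); last exact: ler_wpM2r.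
    by rewrite -mulrA ler_wpM2l // ler_pM.
  apply: le_trans (mul_near (N := n%:R) _ _ hI2 hJ2) _.
  - by rewrite Jn ler0n.
  - by rewrite mulr_ge0 //= ler_piMl.
  by rewrite !mulrA ler_wpM2r //; clear -m1; lra.
have I0n : #|I0|%:R <= n%:R :> R by rewrite -l1 lerDr.
have J0n : #|J0|%:R <= n%:R :> R by rewrite -r1 lerDr.
have I1n : #|I1|%:R <= n%:R :> R by rewrite -l1 lerDl.
have J1n : #|J1|%:R <= n%:R :> R by rewrite -r1 lerDl.
case: (boolP (f (o, o))) => foo.
  have [m1' m2 m3] := main I0 J0 (1 - q) (sub _) (sub _) hq I0n J0n
    (near0 _ _ l2 l3 l1) (near0 _ _ r2 r3 r1).
  rewrite square_gapT // mul1r addrK.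
  set S := \sum_(i in I0) _ in m1' *.
  set a := #|I0|%:R * _ in m1' m2 m3 *.
  have -> : S - C * (1 - q) ^+ 2 * n%:R ^+ 2 = (S - p3 * a) + (p3 * a - C * a)
     + C * (a - ((1 - q) * n%:R) ^+ 2) by ring.
  have m4 : `|C * (a - ((1 - q) * n%:R) ^+ 2)| <= 4 * (m%:R * n%:R).
    by rewrite normrM ger0_norm //; apply: le_trans m3; rewrite ler_piMl.
  have := ler_normD (S - p3 * a + (p3 * a - C * a)) (C * (a - ((1 - q) * n%:R) ^+ 2)).
  have := ler_normD (S - p3 * a) (p3 * a - C * a).
  by move: m1' m2 m4; clear; lra.
have hq' : 0 <= q <= 1 by rewrite q0.
have [m1' m2 m3] := main I1 J1 q (sub _) (sub _) hq' I1n J1n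
  (near1 _ l2 l3) (near1 _ r2 r3).
rewrite square_gapF // mul0r sub0r.
have -> : \sum_(i in I1) \sum_(j in J1) (1 - (f (i, j))%:R) =
    #|I1|%:R * #|J1|%:R - \sum_(i in I1) \sum_(j in J1) (f (i, j))%:R :> R.
  have -> : #|I1|%:R * #|J1|%:R = \sum_(i in I1) \sum_(j in J1) 1 :> R.
    by rewrite sum_const2 mul1r.
  by rewrite -sumrB; apply: eq_bigr => i _; rewrite -sumrB.
set S := \sum_(i in I1) _ in m1' *.
set a := #|I1|%:R * _ in m1' m2 m3 *.
have -> : - (a - S) - - ((1 - C) * q ^+ 2) * n%:R ^+ 2 = (S - p3 * a)
   + (p3 * a - C * a) - (1 - C) * (a - (q * n%:R) ^+ 2) by ring.
have m4 : `|(1 - C) * (a - (q * n%:R) ^+ 2)| <= 4 * (m%:R * n%:R).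
  rewrite normrM ger0_norm ?subr_ge0 //; apply: le_trans m3.
  by rewrite ler_piMl // lerBlDr lerDl.
have := ler_normB (S - p3 * a + (p3 * a - C * a)) ((1 - C) * (a - (q * n%:R) ^+ 2)).
have := ler_normD (S - p3 * a) (p3 * a - C * a).
by move: m1' m2 m4; clear; lra.
Qed.

(** Applied to the rare tables of large discrepancy. *)
Lemma square_gap_bound (R : realType) (m n : nat) (o : 'I_(m + n)) (c1 c2 : R)
    (f : {ffun 'I_(m + n) * 'I_(m + n) -> bool}) :
  0 <= c1 <= 1 -> 0 <= c2 <= 1 ->
  `|square_gap R o f - ((f (o, o))%:R * (c1 + c2) - c2) * n%:R ^+ 2| <= n%:R ^+ 2.
Proof.
move=> /andP[c10 c11] /andP[c20 c21].
have n0 : 0 <= n%:R ^+ 2 :> R by rewrite sqr_ge0.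
have sumE (x : R) :
    \sum_(i in bottom m n) \sum_(j in bottom m n) x = x * n%:R ^+ 2.
  by rewrite !sum_bottom -[LHS]mulr_natr -[x *+ _]mulr_natr; ring.
have [g0 g1] : (if f (o, o) then 0 else -1) * n%:R ^+ 2 <= square_gap R o f /\
    square_gap R o f <= (if f (o, o) then 1 else 0) * n%:R ^+ 2.
  rewrite -!sumE; split; apply: ler_sum => i _; apply: ler_sum => j _;
    case: (f (o, o)) => /=; rewrite ?subr0 ?sub0r ?lerN2;
    by case: (f (o, j)); case: (f (i, o)); case: (f (i, j));
      rewrite /= ?oppr0 ?lexx ?ler01 ?lerN10.
move: g0 g1; rewrite ler_norml; case: (f (o, o)) => /= g0 g1;
  by apply/andP; split; nra.
Qed.

(** The gap has mean zero, so averaging square_gap_near over the tables leaves a linear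
equation for the mean of f (o, o). *)
Lemma top_left_mean (R : realType) (m n s t : nat) (o : 'I_(m + n))
    (q C p1 p2 p3 lam eta : R)
    (M := with_margins (@block_margin m n s t) (@block_margin m n s t))
    (c1 := C * (1 - q) ^+ 2) (c2 := (1 - C) * q ^+ 2 : R) :
  (0 < m)%N -> 0 <= q <= 1 -> 0 <= C <= 1 -> `|s%:R - q * n%:R| <= 1 ->
  `|p3 - C| * n%:R <= m%:R -> (o < m)%N -> 0 <= lam ->
  (#|[set f in M | large_disc (@block_prob R m n p1 p2 p3) lam f]%SET|%:R : R)
    <= #|M|%:R * eta ->
  `|(c1 + c2) * \sum_(f in M) (f (o, o))%:R - c2 * #|M|%:R| * n%:R ^+ 2
    <= #|M|%:R * (lam + 5 * (m%:R * n%:R) + eta * n%:R ^+ 2) :> R.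
Proof.
move=> m0 hq hC hs hp3 om lam0 hbad.
have gap0 : \sum_(f in M) square_gap R o f = 0.
  rewrite /square_gap exchange_big /= big1 // => i iB.
  rewrite exchange_big /= big1 // => j jB.
  move: iB jB; rewrite !inE => iB jB.
  have oi : o != i by apply: contraTneq iB => <-; rewrite -ltnNge.
  have oj : o != j by apply: contraTneq jB => <-; rewrite -ltnNge.
  by rewrite sumrB (switching_identity R _ _ oi oj) subrr.
have [h1 h2] : 0 <= c1 <= 1 /\ 0 <= c2 <= 1.
  move: hq hC => /andP[? ?] /andP[? ?]; rewrite /c1 /c2; split.
    by rewrite mulr_ge0 ?sqr_ge0 ?mulr_ile1 ?sqr_ge0 ?expr_le1 //; lra.
  by rewrite mulr_ge0 ?sqr_ge0 ?mulr_ile1 ?sqr_ge0 ?expr_le1 //; lra.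
have n20 : 0 <= n%:R ^+ 2 :> R by exact: sqr_ge0.
have -> : `|(c1 + c2) * \sum_(f in M) (f (o, o))%:R - c2 * #|M|%:R| * n%:R ^+ 2
   = `|\sum_(f in M) (square_gap R o f
         - ((f (o, o))%:R * (c1 + c2) - c2) * n%:R ^+ 2)|.
  rewrite sumrB gap0 sub0r normrN -mulr_suml normrM [`|n%:R ^+ 2|]ger0_norm //.
  rewrite sumrB sumr_const -mulr_suml -[c2 *+ _]mulr_natr.
  by rewrite [_ * (c1 + c2)]mulrC.
apply: le_trans (ler_norm_sum _ _ _) _.
pose bad := large_disc (@block_prob R m n p1 p2 p3) lam.
apply: (@le_trans _ _ (\sum_(f in M) (lam + 5 * (m%:R * n%:R)
     + (bad f)%:R * n%:R ^+ 2))).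
  apply: ler_sum => f fM; case: (boolP (bad f)) => hbf.
    rewrite mul1r; apply: le_trans (square_gap_bound o f h1 h2) _.
    by rewrite lerDr addr_ge0 // !mulr_ge0.
  rewrite mul0r addr0; exact: square_gap_near hC hs hp3 om fM hbf.
rewrite big_split /= sumr_const -mulr_suml -[X in X + _]mulr_natl.
rewrite [leRHS]mulrDr lerD2l [leRHS]mulrA ler_wpM2r ?sqr_ge0 //.
apply: le_trans hbad; rewrite -sum1_card natr_sum sum_filter.
by apply: ler_sum => f _; rewrite /bad; case: large_disc.
Qed.

(** * Expectations as averages *)

Definition cells (N : nat) (A : 'M[bool]_N) : {ffun 'I_N * 'I_N -> bool} :=
  [ffun x => A x.1 x.2].

Lemma sum_tables (R : realType) (N : nat) (r c : 'I_N -> nat)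
    (F : {ffun 'I_N * 'I_N -> bool} -> R) :
  \sum_(A in binary_tables r c) F (cells A) = \sum_(f in with_margins r c) F f.
Proof.
pose mx (f : {ffun 'I_N * 'I_N -> bool}) : 'M[bool]_N := \matrix_(i, j) f (i, j).
have mxK : cancel mx (@cells N).
  by move=> f; apply/ffunP => [[i j]]; rewrite ffunE mxE.
have cellsK : cancel (@cells N) mx.
  by move=> A; apply/matrixP => i j; rewrite mxE ffunE.
rewrite [RHS](reindex (@cells N)); last by exists mx => x _.
apply: eq_bigl => A; rewrite !inE; congr (_ && _); apply: eq_forallb => k;
  congr (_ == _); apply: eq_bigr => b _; by rewrite ffunE.
Qed.

Lemma uniform_event (R : realType) (d : measure_display)
    (T : measurableType d) (P : probability T R) (U : finType) (X : T -> U)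
    (S : {set U}) (D : {pred U}) : uniform_on P X S ->
  measurable (X @^-1` [set` D]) /\
  P (X @^-1` [set` D]) = (#|[set u in S | D u]%SET|%:R / #|S|%:R)%:E.
Proof.
move=> hX.
have -> : X @^-1` [set` D] = \bigcup_(u in [set` D]) (X @^-1` [set u]).
  apply/seteqP; split => [w /= Dw|w [u /= Du wu]].
    by exists (X w).
  by rewrite /= wu.
have fD : finite_set [set` D] by exact: finite_finset.
split; first by apply: fin_bigcup_measurable => // u _; case: (hX u).
rewrite measure_fin_bigcup //; last 2 first.
- by move=> u v _ _ [w [/= <- <-]].
- by move=> u _; case: (hX u).
rewrite -(@bigfs _ _ _ _ (index_enum U)) ?index_enum_uniq //; last first.
  by move=> u _; rewrite mem_index_enum.
rewrite (eq_bigr _ (fun u _ => (hX u).2)).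
rewrite sumEFin -big_mkcondr /= sumr_const -[_ *+ _]mulr_natl.
congr (_ %:R * _)%:E; apply: eq_card => u.
by rewrite !inE andbC.
Qed.

Lemma uniform_card_gt0 (R : realType) (d : measure_display)
    (T : measurableType d) (P : probability T R) (U : finType) (X : T -> U)
    (S : {set U}) : uniform_on P X S -> (0 < #|S|)%N.
Proof.
move=> /(uniform_event predT)[_]; rewrite lt0n => h; apply/negP => /eqP S0.
move: h; rewrite (_ : X @^-1` _ = setT); last by apply/seteqP.
rewrite probability_setT S0 invr0 mulr0 => -[/eqP]; by rewrite oner_eq0.
Qed.

Lemma uniform_expectation (R : realType) (d : measure_display)
    (T : measurableType d) (P : probability T R) (U : finType) (X : T -> U)
    (S : {set U}) (D : {pred U}) : uniform_on P X S ->
  fine 'E_P[fun w => (D (X w))%:R] = (\sum_(u in S) (D u)%:R) / #|S|%:R.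
Proof.
move=> hX; have [mD PD] := uniform_event D hX.
have -> : (fun w => (D (X w))%:R) = \1_(X @^-1` [set` D]) :> (T -> R).
  apply/funext => w; rewrite indicE; congr ((nat_of_bool _)%:R).
  by apply/idP/idP; rewrite inE.
rewrite expectation_indic // PD /=; congr (_ / _).
rewrite -sum1_card natr_sum sum_filter; apply: eq_bigr => u _.
by case: (D u).
Qed.

Lemma expectation_entry (R : realType) (d : measure_display)
    (T : measurableType d) (P : probability T R) (N : nat)
    (X : T -> 'M[bool]_N) (r c : 'I_N -> nat) (i j : 'I_N) (k : nat)
    (M := with_margins r c) :
  uniform_on P X (binary_tables r c) -> (1 <= k)%N ->
  (0 < #|M|)%N /\
  #|M|%:R * fine 'E_P[fun w => entry R (X w) i.+1 j.+1 ^+ k] =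
    \sum_(f in M) (f (i, j))%:R.
Proof.
move=> hX k0.
have cM : #|binary_tables r c|%:R = #|M|%:R :> R.
  rewrite -!sum1_card !natr_sum.
  exact: (sum_tables r c (fun=> 1 : R)).
have M0 : (0 < #|M|)%N.
  by rewrite -(ltr_nat R) -cM ltr_nat; exact: uniform_card_gt0 hX.
split => //.
have -> : (fun w => entry R (X w) i.+1 j.+1 ^+ k) =
    (fun w => ((fun A : 'M[bool]_N => A i j) (X w))%:R).
  apply/funext => w; rewrite entryE.
  by case: (X w i j); rewrite ?expr1n // expr0n; case: k k0.
rewrite (uniform_expectation (fun A : 'M[bool]_N => A i j) hX) cM mulrC divfK.
  rewrite -(sum_tables r c (fun f => (f (i, j))%:R)).
  by apply: eq_bigr => A _; rewrite ffunE.
by rewrite pnatr_eq0 -lt0n.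
Qed.

(** * Rates *)

Lemma bigO_le (R : realType) (f g : nat -> R^o) (K : R) :
  (\forall n \near \oo, `|f n| <= K * g n) -> (forall n, 0 <= g n) ->
  f =O_\oo g.
Proof.
move=> h g0; apply/eqO_exP; exists (`|K| + 1); first by rewrite ltr_wpDl.
apply: filterS h => n /le_trans; apply; rewrite (ger0_norm (g0 n)).
by rewrite ler_wpM2r // (le_trans (ler_norm K)) // lerDl.
Qed.

Lemma near_powR_ge (R : realType) (a A : R) : 0 < a ->
  \forall n \near \oo, A <= n%:R `^ a.
Proof.
move=> a0; apply: filterS (nbhs_infty_gtr (`|A| `^ a^-1)) => n hn.
apply: le_trans (ler_norm A) _.
have -> : `|A| = (`|A| `^ a^-1) `^ a.
  by rewrite -powRrM mulVf ?gt_eqF // powRr1.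
by apply: ge0_ler_powR; rewrite ?nnegrE ?powR_ge0 ?ler0n ?(ltW a0) ?(ltW hn).
Qed.

Lemma ln_le_powR (R : realType) (x e : R) : 0 < x -> 0 < e ->
  ln x <= e^-1 * x `^ e.
Proof.
move=> x0 e0; have := ltW (ln_sublinear (powR_gt0 e x0)).
by rewrite ln_powR ler_pdivlMl.
Qed.

(** With N <= 2 n, the factors other than the Chernoff term, multiplied by n, are at most
expR (1263 n sqrt n ln n - 4 ln c0 m^2).  The part w of lam / n absorbs the first term,
as 32 * 1263 <= 40^3, and the part K m absorbs the second one, as K^2 >= - 128 ln c0. *)
Lemma failure_le (R : realType) (m n L : nat) (c0 K e w lam : R)
    (N := (m + n)%N) :
  (m <= n)%N -> 16 <= n%:R :> R -> 0 < c0 -> 5 <= c0 * n%:R ->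
  L%:R <= 420 * (n%:R * Num.sqrt n%:R) :> R ->
  0 <= K -> - ln c0 * 128 <= K ^+ 2 -> 0 <= e -> 40 ^+ 3 * ln n%:R <= e ->
  0 <= w -> w ^+ 2 = n%:R * Num.sqrt n%:R * e ->
  lam = n%:R * (w + K * m%:R) ->
  (2 * (c0^-1 * ((N * N).+1)%:R) ^+ L) *
    (expR (- ln c0 * 4 * m%:R ^+ 2) *
     (4 ^+ N * (2 * expR (- (lam ^+ 2 / (8 * N%:R ^+ 2)))))) <= n%:R^-1.
Proof.
move=> mn n16 c00 c5 hL K0 hK e0 he w0 w2 lamE.
have N2n : (N <= 2 * n)%N by rewrite /N mul2n -addnn leq_add2r.
have n0 : 0 < n%:R :> R by lra.
have nn0 : n%:R != 0 :> R by rewrite gt_eqF.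
set x : R := n%:R in n16 c5 hL he w2 lamE n0 nn0 *.
set S := Num.sqrt x in hL w2.
have S1 : 1 <= S by rewrite -sqrtr1 ler_wsqrtr //; lra.
have N2 : N%:R <= 2 * x by rewrite -natrM ler_nat.
have Nx : x <= N%:R by rewrite ler_nat /N leq_addl.
have l0 : 0 <= ln x by apply: ln_ge0; lra.
have h1 : c0^-1 * ((N * N).+1)%:R <= expR (3 * ln x).
  have -> : expR (3 * ln x) = x ^+ 3 by rewrite -[3]/(3%:R) expRM_natl lnK.
  rewrite mulrC ler_pdivrMr // -natr1 natrM.
  have : N%:R * N%:R <= 2 * x * (2 * x) by apply: ler_pM.
  have : x ^+ 2 * 5 <= x ^+ 2 * (c0 * x) by rewrite ler_wpM2l ?sqr_ge0.
  have : 1 <= x ^+ 2 by rewrite expr_ge1 //; lra.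
  rewrite !exprS expr0; lra.
have h2 : (c0^-1 * ((N * N).+1)%:R) ^+ L <= expR (L%:R * (3 * ln x)).
  rewrite expRM_natl lerXn2r ?nnegrE ?expR_ge0 //.
  by rewrite mulr_ge0 // invr_ge0 ltW.
(* 4^N <= 16^n <= n^n *)
have h3 : 4 ^+ N <= expR (x * ln x).
  rewrite expRM_natl lnK ?posrE //.
  apply: (@le_trans _ _ (16 ^+ n)).
    have -> : 16 = 4 ^+ 2 :> R by rewrite -natrX.
    rewrite -exprM; apply: ler_weXn2l; first by lra.
    exact: N2n.
  by rewrite lerXn2r ?nnegrE //; lra.
have h4 : 4 <= expR (ln x) by rewrite lnK ?posrE //; lra.
have h5 : w ^+ 2 / 32 + K ^+ 2 * m%:R ^+ 2 / 32 <= lam ^+ 2 / (8 * N%:R ^+ 2).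
  rewrite ler_pdivlMr; last by rewrite mulr_gt0 // exprn_gt0 //; lra.
  have a1 : w ^+ 2 + K ^+ 2 * m%:R ^+ 2 <= (w + K * m%:R) ^+ 2.
    have : 0 <= w * (K * m%:R) by rewrite !mulr_ge0.
    by rewrite -exprMn; nra.
  have a2 : N%:R ^+ 2 <= 4 * x ^+ 2.
    have : N%:R * N%:R <= 2 * x * (2 * x) by apply: ler_pM.
    by rewrite !expr2; lra.
  rewrite lamE exprMn.
  have b0 : 0 <= w ^+ 2 + K ^+ 2 * m%:R ^+ 2.
    by rewrite addr_ge0 ?mulr_ge0 ?sqr_ge0.
  have := ler_wpM2l b0 a2; have := ler_wpM2l (sqr_ge0 x) a1; clear; lra.
set T1 := _ ^+ L in h2 *; set T2 := 4 ^+ N in h3 *.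
have T10 : 0 <= T1 by rewrite exprn_ge0 // mulr_ge0 // invr_ge0 ltW.
have T20 : 0 <= T2 by rewrite exprn_ge0.
set u := lam ^+ 2 / _ in h5 *.
have -> : 2 * T1 * (expR (- ln c0 * 4 * m%:R ^+ 2) * (T2 * (2 * expR (- u))))
  = 4 * T1 * T2 * expR (- ln c0 * 4 * m%:R ^+ 2 - u).
  by rewrite expRD; ring.
have -> : x^-1 = expR (- ln x) by rewrite expRN lnK.
apply: (@le_trans _ _ (expR (ln x) * expR (L%:R * (3 * ln x)) *
   expR (x * ln x) * expR (- ln c0 * 4 * m%:R ^+ 2 - u))).
  rewrite ler_wpM2r ?expR_ge0 //; apply: ler_pM => //.
    by rewrite mulr_ge0.
  by apply: ler_pM.
rewrite -!expRD ler_expR.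
have k1 : - ln c0 * 4 * m%:R ^+ 2 <= K ^+ 2 * m%:R ^+ 2 / 32.
  by have := ler_wpM2r (sqr_ge0 (m%:R : R)) hK; clear; lra.
have xS : x <= x * S by rewrite ler_peMr // ltW.
have xS0 : 0 <= x * S by rewrite (le_trans (ltW n0)).
have k2 : (2 + x + 3 * L%:R) * ln x <= 1263 * (x * S) * ln x.
  by rewrite ler_wpM2r //; clear -xS hL n16; lra.
have k3 : 40 ^+ 3 * (x * S) * ln x <= w ^+ 2.
  by rewrite w2 [_ * (x * S)]mulrC -[leLHS]mulrA ler_wpM2l.
have k4 : 0 <= x * S * ln x by rewrite mulr_ge0.
move: k1 k2 k3 k4 h5; clear; lra.
Qed.

Lemma truncn_bounds (R : realType) (x : R) : 0 <= x ->
  (Num.truncn x)%:R <= x /\ x <= (Num.truncn x)%:R + 1.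
Proof.
by move=> /truncn_itv /andP[h1 h2]; split=> //; rewrite natr1 ltW.
Qed.

Lemma powR_unit (R : realType) (x a b : R) : 0 < x -> a + b = 0 ->
  x `^ a * x `^ b = 1.
Proof.
move=> x0 ab; rewrite -powRD; first by rewrite ab powRr0.
by rewrite (gt_eqF x0) implybT.
Qed.

Lemma top_size (R : realType) (n : nat) (delta : R) :
  0 <= delta <= 1 -> (0 < n)%N ->
  let m := Num.truncn (n%:R `^ delta) in
  [/\ (0 < m)%N, (m <= n)%N & m%:R <= n%:R * n%:R `^ (delta - 1)].
Proof.
move=> /andP[d0 d1] n0 m.
have n1 : 1 <= n%:R :> R by rewrite ler1n.
have m1 : m%:R <= n%:R `^ delta by case: (truncn_bounds (powR_ge0 n%:R delta)).
split.
- by rewrite truncn_gt0 -[leLHS](powRr0 (n%:R : R)) ler_powR.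
- rewrite -(ler_nat R); apply: le_trans m1 _.
  by rewrite -[leRHS]powRr1 ?ler0n // ler_powR.
- rewrite -{1}[n%:R]powRr1 ?ler0n // -powRD ?[1 + _]addrC ?subrK //.
  by rewrite pnatr_eq0 -lt0n n0 implybT.
Qed.

Lemma inv_le_rate (R : realType) (n : nat) (delta : R) :
  0 <= delta -> (0 < n)%N -> n%:R^-1 <= n%:R `^ (delta - 1) :> R.
Proof.
move=> d0 n0; rewrite -powR_inv1 ?ler0n // ler_powR ?ler1n //.
by rewrite lerBrDr addrC subrr.
Qed.

Lemma truncn_dist_le1 (R : realType) (x : R) : 0 <= x ->
  `|(Num.truncn x)%:R - x| <= 1.
Proof.
by move=> /truncn_bounds[h1 h2]; rewrite ler_norml; apply/andP; split; lra.
Qed.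

(** Here u stands for m / n. *)
Lemma block_prob_ranges (R : realType) (q C u c0 : R)
    (p2 := q * (1 - u)) (p3 := C - p2 * u) :
  0 < c0 -> 2 * c0 <= q -> 2 * c0 <= 1 - q -> 2 * c0 <= C -> 2 * c0 <= 1 - C ->
  0 <= u <= c0 ->
  [/\ c0 <= q <= 1 - c0, c0 <= p2 <= 1 - c0, c0 <= p3 <= 1 - c0 &
      `|p3 - C| <= u].
Proof.
move=> c00 cq cq1 cC cC1 /andP[u0 uc].
have qu0 : 0 <= q * u by apply: mulr_ge0; lra.
have quc : q * u <= u by rewrite ler_piMl //; lra.
have p2E : p2 = q - q * u by rewrite /p2; ring.
have p2u0 : 0 <= p2 * u by apply: mulr_ge0; lra.
have p2uc : p2 * u <= u by rewrite ler_piMl //; lra.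
rewrite /p3; split; try (apply/andP; split; lra).
by rewrite ler_norml; apply/andP; split; lra.
Qed.

(** The constants that uniform_large_disc needs: the repair budget L is linear in
N sqrt N, hence negligible against c0 h^2, which is quadratic in n. *)
Lemma repair_budget (R : realType) (m n : nat) (c0 : R) (N := (m + n)%N)
    (NS : R := N%:R * Num.sqrt N%:R) (L := (Num.truncn (104 * NS)).+1)
    (h := Num.truncn (c0 * n%:R)) :
  (m <= n)%N -> 16 <= n%:R :> R -> 0 < c0 -> 5 <= c0 * n%:R ->
  40 * 50 / c0 ^+ 3 <= n%:R `^ 2^-1 ->
  [/\ 96 * NS + 8 * N%:R <= L%:R, 6 * NS + L%:R < c0 * h%:R ^+ 2 &
      L%:R <= 420 * (n%:R * Num.sqrt n%:R) :> R].
Proof.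
move=> mn n16 c00 c5.
have x0 : 0 <= n%:R :> R by rewrite ler0n.
rewrite powR12_sqrt // ler_pdivrMr ?exprn_gt0 // [Num.sqrt _ * _]mulrC.
have S1 : 1 <= Num.sqrt n%:R :> R.
  by rewrite -[leLHS]sqrtr1 ler_wsqrtr // (le_trans _ n16) // ler1n.
have S2 : Num.sqrt n%:R ^+ 2 = n%:R :> R by rewrite sqr_sqrtr.
have N2 : N%:R <= 2 * n%:R :> R.
  by rewrite -natrM ler_nat /N mul2n -addnn leq_add2r.
have N0 : 0 <= N%:R :> R by rewrite ler0n.
have Nx : n%:R <= N%:R :> R by rewrite ler_nat /N leq_addl.
have SN2 : Num.sqrt N%:R <= 2 * Num.sqrt n%:R :> R.
  have -> : 2 * Num.sqrt n%:R = Num.sqrt (2 ^+ 2 * n%:R) :> R.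
    by rewrite sqrtrM ?sqr_ge0 // sqrtr_sqr ger0_norm.
  by rewrite ler_wsqrtr // expr2; lra.
have SN1 : 1 <= Num.sqrt N%:R :> R.
  rewrite -[leLHS]sqrtr1 ler_wsqrtr //; apply: le_trans Nx.
  by apply: le_trans n16; rewrite ler1n.
have NS4 : NS <= 4 * (n%:R * Num.sqrt n%:R).
  have := ler_pM N0 (le_trans ler01 SN1) N2 SN2; rewrite -/NS; lra.
have NS1 : N%:R <= NS by rewrite ler_peMr.
have nS : n%:R <= n%:R * Num.sqrt n%:R :> R by rewrite ler_peMr.
have NS0 : 0 <= 104 * NS by rewrite mulr_ge0 // (le_trans N0).
have [Lle _] := truncn_bounds NS0.
have Lge : 104 * NS <= L%:R by apply/ltW; exact: truncnS_gt.
have LE : L%:R = (Num.truncn (104 * NS))%:R + 1 :> R by rewrite natr1.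
have c0n : 0 <= c0 * n%:R by rewrite mulr_ge0 // ltW.
have [_ h2] := truncn_bounds c0n.
move: NS4 NS1 nS Lle Lge LE h2 S1 S2 n16 c5; rewrite -/h.
move: (Num.truncn (104 * NS))%:R (L%:R : R) (h%:R : R) => l L' h'.
move: (n%:R : R) (N%:R : R) (NS : R) (Num.sqrt n%:R) => x N' NS' S.
clear -c00 => NS4 NS1 nS Lle Lge LE h2 S1 S2 n16 c5 Sc.
split; [lra | | lra].
have hh1 : c0 * x / 2 <= h' by lra.
have x0 : 0 <= x by lra.
have hh : (c0 * x / 2) ^+ 2 <= h' ^+ 2.
  have c1 : 0 <= c0 * x / 2 by rewrite divr_ge0 // mulr_ge0 // ltW.
  by rewrite ler_pXn2r ?nnegrE // (le_trans c1).
have := ler_wpM2l (ltW c00) hh.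
have -> : c0 * (c0 * x / 2) ^+ 2 = (c0 ^+ 3 * S) * (x * S) / 4.
  have -> : c0 ^+ 3 * S * (x * S) = c0 ^+ 3 * x * S ^+ 2 by ring.
  by rewrite S2; field.
have xS0 : 0 <= x * S by lra.
have := ler_wpM2r xS0 Sc; lra.
Qed.

Lemma log_le_rate (R : realType) (A x eps : R) : 0 <= A -> 0 < x -> 0 < eps ->
  A * (eps / 2)^-1 <= x `^ (eps / 2) -> A * ln x <= x `^ eps.
Proof.
move=> A0 x0 e0 hA; have e20 : 0 < eps / 2 by rewrite divr_gt0.
have z0 : 0 <= x `^ (eps / 2) by exact: powR_ge0.
rewrite [eps in leRHS]splitr powRD; last by rewrite (gt_eqF x0) implybT.
apply: le_trans (ler_wpM2r z0 hA).
by rewrite -[leRHS]mulrA ler_wpM2l // ln_le_powR.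
Qed.

(** The square of the left side is x^2 times the product of the two rates, so the bound is
an inequality between the geometric mean and the sum. *)
Lemma fluctuation_le_rate (R : realType) (x delta eps : R) : 0 < x ->
  Num.sqrt (x * Num.sqrt x * x `^ eps) <=
  x * (x `^ (delta - 1) + x `^ (1 / 2 - delta + eps)).
Proof.
move=> x0; set r := x `^ (delta - 1); set v := x `^ (1 / 2 - _ + _).
have r0 : 0 < r by exact: powR_gt0.
have v0 : 0 < v by exact: powR_gt0.
have rv : x * (r * v) = Num.sqrt x * x `^ eps.
  rewrite -powR12_sqrt ?(ltW x0) // /r /v -{1}[x]powRr1 ?(ltW x0) //.
  rewrite -!powRD ?(gt_eqF x0) ?implybT //.
  by congr (_ `^ _); lra.
have w0 : 0 <= x * Num.sqrt x * x `^ eps.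
  by rewrite !mulr_ge0 ?sqrtr_ge0 ?powR_ge0 // ltW.
have t0 : 0 <= x * (r + v) by rewrite mulr_ge0 ?addr_ge0 ?ltW.
rewrite -(@ler_pXn2r _ 2) ?nnegrE ?sqrtr_ge0 // sqr_sqrtr //.
rewrite -mulrA -rv exprMn expr2 -!mulrA !ler_wpM2l ?(ltW x0) //.
rewrite sqrrD; have := sqr_ge0 r; have := sqr_ge0 v.
have : 0 < r * v by rewrite mulr_gt0.
by rewrite mulr2n; lra.
Qed.

Lemma total_error_le (R : realType) (x m r v w K : R) :
  0 <= K -> 0 < x -> 0 <= r -> 0 <= v -> x^-1 <= r -> w <= x * (r + v) ->
  m <= x * r ->
  x * (w + K * m) + 5 * (m * x) + x^-1 * x ^+ 2 <= (K + 7) * (r + v) * x ^+ 2.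
Proof.
move=> K0 x0 r0 v0 xr hw hm.
have k1 : x^-1 * x ^+ 2 <= r * x ^+ 2 by rewrite ler_wpM2r // sqr_ge0.
have k2 : x * (w + K * m) <= (r + v + K * r) * x ^+ 2.
  rewrite expr2 mulrA [_ * x]mulrC ler_wpM2l ?(ltW x0) //.
  have := ler_wpM2l K0 hm; lra.
have k3 : 5 * (m * x) <= 5 * r * x ^+ 2.
  have := ler_wpM2r (ltW x0) hm; rewrite expr2; lra.
have k4 : 0 <= v * x ^+ 2 by rewrite mulr_ge0 ?sqr_ge0.
have k5 : 0 <= K * (v * x ^+ 2) by rewrite mulr_ge0.
have k6 : 0 <= r * x ^+ 2 by rewrite mulr_ge0 ?sqr_ge0.
lra.
Qed.

(** The parameters are chosen here: h = [c0 n] zeros per line are guaranteed, the repair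
budget is of order N sqrt N, and lam = n (w + K m) with w^2 = n^(3/2 + eps). *)
Lemma top_left_bound (R : realType) (q C delta eps c0 : R) (n : nat)
    (m := Num.truncn ((n%:R : R) `^ delta))
    (mg := @block_margin m n (Num.truncn (q * n%:R)) (Num.truncn (C * n%:R)))
    (M := with_margins mg mg) (c1 := C * (1 - q) ^+ 2)
    (c2 := (1 - C) * q ^+ 2) (K := Num.sqrt (- ln c0 * 128)) (o : 'I_(m + n)) :
  0 < q < 1 -> 0 < C < 1 -> 0 <= delta < 1 -> 0 < eps -> 0 < c0 ->
  2 * c0 <= q -> 2 * c0 <= 1 - q -> 2 * c0 <= C -> 2 * c0 <= 1 - C ->
  16 <= n%:R :> R -> 5 <= c0 * n%:R -> c0^-1 <= n%:R `^ (1 - delta) ->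
  40 * 50 / c0 ^+ 3 <= n%:R `^ 2^-1 ->
  40 ^+ 3 * (eps / 2)^-1 <= n%:R `^ (eps / 2) -> (o < m)%N ->
  `|(c1 + c2) * \sum_(f in M) (f (o, o))%:R - c2 * #|M|%:R|
    <= #|M|%:R * ((K + 7) * (n%:R `^ (delta - 1) + n%:R `^ (1 / 2 - delta + eps))).
Proof.
move=> /andP[q0 q1] /andP[C0 C1] /andP[d0 d1] e0 c00 cq cq1 cC cC1 n16 c5 hr hS
  hE om.
have hK : - ln c0 * 128 <= K ^+ 2.
  by rewrite sqr_sqrtr // mulr_ge0 ?oppr_ge0 // ln_le0 //; clear -c00 cq q1; lra.
have K0 : 0 <= K by exact: sqrtr_ge0.
have n0 : (0 < n)%N by rewrite -(ltr_nat R) (lt_le_trans _ n16).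
have d01 : 0 <= delta <= 1 by rewrite d0 ltW.
have [m0 mn mr] := top_size d01 n0; rewrite -/m in m0 mn mr.
have nr := inv_le_rate d0 n0.
have x0 : 0 < n%:R :> R by rewrite ltr0n.
have w_le := fluctuation_le_rate delta eps x0.
have A0 : 0 <= 40 ^+ 3 :> R by exact: exprn_ge0.
have lnE := log_le_rate A0 x0 e0 hE.
have [L96 Lh L420] := repair_budget mn n16 c00 c5 hS.
have E0 : 0 <= (n%:R : R) `^ eps by exact: powR_ge0.
pose u : R := m%:R / n%:R.
have u0 : 0 <= u by rewrite divr_ge0 // ltW.
have ux : u * n%:R = m%:R by rewrite divfK // gt_eqF.
have uc : 0 <= u <= c0.
  rewrite u0 /=; have ur : u <= n%:R `^ (delta - 1).
    by rewrite ler_pdivrMr // mulrC.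
  apply: le_trans ur _.
  have h : (n%:R : R) `^ (delta - 1) * n%:R `^ (1 - delta) = 1.
    by apply: powR_unit => //; clear; lra.
  have := ler_wpM2l (powR_ge0 (n%:R : R) (delta - 1)) hr.
  by rewrite h ler_pdivrMr // mul1r.
have [hp1 hp2 hp3 hpC] := block_prob_ranges c00 cq cq1 cC cC1 uc.
set p2 := q * (1 - u) in hp2 hp3 hpC; set p3 := C - p2 * u in hp3 hpC.
set w := Num.sqrt _ in w_le.
have w0 : 0 <= w by exact: sqrtr_ge0.
have w2 : w ^+ 2 = n%:R * Num.sqrt n%:R * n%:R `^ eps.
  by rewrite sqr_sqrtr // !mulr_ge0 ?sqrtr_ge0 // ltW.
pose lam := n%:R * (w + K * m%:R).
have lam0 : 0 <= lam by rewrite mulr_ge0 ?addr_ge0 ?mulr_ge0 // ltW.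
have qx0 : 0 <= q * n%:R by rewrite mulr_ge0 // ltW.
have Cx0 : 0 <= C * n%:R by rewrite mulr_ge0 // ltW.
have cx0 : 0 <= c0 * n%:R by rewrite mulr_ge0 // ltW.
have fits (y : R) : 0 <= y -> 2 * c0 <= 1 - y ->
    (Num.truncn (y * n%:R) + Num.truncn (c0 * n%:R) <= m + n)%N.
  move=> y0 cy; have [y1 _] := truncn_bounds (mulr_ge0 y0 (ltW x0)).
  have [h1 _] := truncn_bounds cx0.
  rewrite -(ler_nat R) natrD; apply: le_trans (lerD y1 h1) _.
  rewrite -mulrDl; apply: (@le_trans _ _ (n%:R : R)).
    by rewrite ler_piMl ?(ltW x0) //; clear -cy c00; lra.
  by rewrite ler_nat leq_addl.
have hbad : #|[set f in M | large_disc (@block_prob R m n q p2 p3) lam f]%SET|%:R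
    <= #|M|%:R * n%:R^-1 :> R.
  apply: le_trans (@uniform_large_disc R m n (Num.truncn (q * n%:R))
    (Num.truncn (C * n%:R)) _ _ q p2 p3 c0 lam n0 c00 hp1 hp2 hp3 _ _
    (fits q (ltW q0) cq1) (fits C (ltW C0) cC1) L96 Lh lam0) _.
  - have -> : m%:R * q + n%:R * p2 = q * n%:R by rewrite -ux /p2; ring.
    by rewrite distrC; exact: truncn_dist_le1.
  - have -> : m%:R * p2 + n%:R * p3 = C * n%:R by rewrite -ux /p3; ring.
    by rewrite distrC; exact: truncn_dist_le1.
  rewrite ler_wpM2l //.
  exact: (@failure_le R m n _ c0 K _ w lam mn n16 c00 c5 L420 K0 hK E0 lnE w0 w2).
have hp3' : `|p3 - C| * n%:R <= m%:R by rewrite -ux ler_wpM2r // ltW.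
have q01 : 0 <= q <= 1 by rewrite !ltW.
have C01 : 0 <= C <= 1 by rewrite !ltW.
have := @top_left_mean R m n (Num.truncn (q * n%:R)) (Num.truncn (C * n%:R)) o
  q C q p2 p3 lam n%:R^-1 m0 q01 C01 (truncn_dist_le1 qx0) hp3' om lam0 hbad.
rewrite -/mg -/M -/c1 -/c2 => hmain.
have x20 : 0 < n%:R ^+ 2 :> R by rewrite exprn_gt0.
rewrite -(ler_pM2r x20); apply: le_trans hmain _.
rewrite -[leRHS]mulrA ler_wpM2l //.
exact: total_error_le K0 x0 (powR_ge0 _ _) (powR_ge0 _ _) nr w_le mr.
Qed.

Lemma top_left_rate (R : realType) (q C delta eps : R) :
  0 < q < 1 -> 0 < C < 1 -> 0 <= delta < 1 -> 0 < eps ->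
  exists K : R, \forall n \near \oo,
    let m := Num.truncn ((n%:R : R) `^ delta) in
    let mg := @block_margin m n (Num.truncn (q * n%:R)) (Num.truncn (C * n%:R)) in
    let M := with_margins mg mg in
    let c1 := C * (1 - q) ^+ 2 in let c2 := (1 - C) * q ^+ 2 in
    forall o : 'I_(m + n), (o < m)%N ->
    `|(c1 + c2) * \sum_(f in M) (f (o, o))%:R - c2 * #|M|%:R|
      <= #|M|%:R * (K * (n%:R `^ (delta - 1) + n%:R `^ (1 / 2 - delta + eps))).
Proof.
move=> hq hC hd e0.
have [/andP[q0 q1] /andP[C0 C1]] := (hq, hC).
(* c0 keeps the block probabilities, and the density of zeros in every line, away
   from 0 *)
have [c0 [c00 cq cq1 cC cC1]] : exists c0 : R, [/\ 0 < c0, 2 * c0 <= q,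
    2 * c0 <= 1 - q, 2 * c0 <= C & 2 * c0 <= 1 - C].
  exists (Num.min (Num.min q (1 - q)) (Num.min C (1 - C)) / 2).
  set c := Num.min _ _.
  have -> : 2 * (c / 2) = c by field.
  rewrite /c; split; rewrite ?ge_min ?lexx ?orbT //.
  by rewrite divr_gt0 // !lt_min q0 C0 !subr_gt0 q1 C1.
exists (Num.sqrt (- ln c0 * 128) + 7); near=> n => o om.
apply: (top_left_bound hq hC hd e0 c00) => //; near: n.
- exact: nbhs_infty_ger.
- apply: filterS (nbhs_infty_ger (5 / c0)) => n.
  by rewrite ler_pdivrMr // mulrC.
- by apply: near_powR_ge; rewrite subr_gt0; case/andP: hd.
- exact: near_powR_ge.
- by apply: near_powR_ge; rewrite divr_gt0.
Unshelve. all: by end_near.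
Qed.

(** * The three limits *)

(** Dividing by M n leaves the error m / n of the line sum and the error 1 / n of the
rounding of b, both at most the rate r. *)
Lemma line_mean_near (R : realType) (m n : nat) (S M y a r : R) (b : nat) :
  (0 < n)%N -> 0 < M -> M * a = S -> `|b%:R - y * n%:R| <= 1 ->
  `|n%:R * S - M * b%:R| <= M * m%:R -> m%:R <= n%:R * r -> n%:R^-1 <= r ->
  `|a - y| <= 2 * r.
Proof.
move=> n0 M0 <- hb; have x0 : 0 < n%:R :> R by rewrite ltr0n.
rewrite mulrCA -mulrBr normrM gtr0_norm // ler_pM2l // => h1 h2 h3.
have h4 : 1 <= n%:R * r.
  apply: le_trans (ler_wpM2l (ltW x0) h3); by rewrite mulfV // gt_eqF.
rewrite -(ler_pM2l x0) -{1}[n%:R](gtr0_norm x0) -normrM.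
have -> : n%:R * (a - y) = (n%:R * a - b%:R) + (b%:R - y * n%:R) by ring.
by apply: le_trans (ler_normD _ _) _; lra.
Qed.

Lemma bottom_column_rate (R : realType) (B C delta : R) (n : nat)
    (i j : 'I_(table_size delta n)) (a y : R)
    (M := with_margins (@margin R B C delta n) (@margin R B C delta n)) :
  0 < B -> 0 < C -> 0 <= delta <= 1 -> (0 < n)%N -> (0 < #|M|)%N ->
  (Num.truncn ((n%:R : R) `^ delta) <= j)%N ->
  y = (if (i < Num.truncn ((n%:R : R) `^ delta))%N then B * C else C) ->
  #|M|%:R * a = \sum_(f in M) (f (i, j))%:R ->
  `|a - y| <= 2 * n%:R `^ (delta - 1).
Proof.
move=> B0 C0 hd n0 M0 hj yE aE; have [m0 mn mr] := top_size hd n0.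
have M0' : 0 < #|M|%:R :> R by rewrite ltr0n.
have hmean := @mean_bottom_column R _ n (Num.truncn (B * C * n%:R))
  (Num.truncn (C * n%:R)) i j hj.
have hinv : n%:R^-1 <= n%:R `^ (delta - 1) :> R.
  by apply: inv_le_rate => //; case/andP: hd.
have hb : `|(@margin R B C delta n i)%:R - y * n%:R| <= 1.
  rewrite yE /margin; case: ifP => _; apply: truncn_dist_le1;
    by rewrite !mulr_ge0 // ltW.
exact: (line_mean_near n0 M0' aE hb hmean mr hinv).
Qed.

Lemma ratio_near (R : realType) (s M a c e : R) : 0 < s -> 0 < M ->
  `|s * (M * a) - c * M| <= M * e -> `|a - c / s| <= e / s.
Proof.
move=> s0 M0; have -> : s * (M * a) - c * M = M * (s * (a - c / s)).
  by field; rewrite gt_eqF.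
rewrite 2!normrM (gtr0_norm M0) (gtr0_norm s0) ler_pM2l // => h.
by rewrite ler_pdivlMr // mulrC.
Qed.

Theorem corollary1p3 (R : realType) (B C delta eps : R)
    (hB : 0 < B) (hC : 0 < C) (hdelta : 0 <= delta <= 1) (heps : 0 < eps)
    (d : nat -> measure_display) (T : forall n : nat, measurableType (d n))
    (P : forall n : nat, probability (T n) R)
    (X : forall n : nat, T n -> 'M[bool]_(table_size delta n))
    (hX : \forall n \near \oo,
       uniform_on (P n) (X n) (tables B C delta n))
    (k : nat) (hk : (1 <= k)%N) :
  (* bottom right *)
  (0 <= delta < 1 -> 0 < C <= 1 -> 0 < B <= 1 / C ->
    (fun n : nat =>
       `| fine 'E_(P n)[fun w => entry R (X n w) n.+1 n.+1 ^+ k] - C | : R^o)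
    =O_\oo
    (fun n : nat => n%:R `^ (delta - 1) + n%:R `^ (- (1 / 2) + eps) : R^o))
  /\
  (* top left *)
  (1 / 2 < delta < 1 -> 0 < C < 3 / 4 ->
   0 < B < 1 / (Num.sqrt (C / 3 - C ^+ 2 / 3) + C) ->
    (fun n : nat =>
       `| fine 'E_(P n)[fun w => entry R (X n w) 1 1 ^+ k]
          - B ^+ 2 * (1 - C) / (B ^+ 2 - 2 * B + 1 / C) | : R^o)
    =O_\oo
    (fun n : nat =>
       n%:R `^ (delta - 1) + n%:R `^ (1 / 2 - delta + eps) : R^o))
  /\
  (* side blocks *)
  (0 < delta < 1 -> 0 < C < 3 / 4 ->
   0 < B < 1 / (Num.sqrt (C / 3 - C ^+ 2 / 3) + C) ->
    (fun n : nat =>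
       `| fine 'E_(P n)[fun w => entry R (X n w) 1 n.+1 ^+ k] - B * C | : R^o)
    =O_\oo
    (fun n : nat =>
       n%:R `^ (delta - 1) + n%:R `^ (- (delta / 2) + eps) : R^o)).

Proof.
have [d0 d1] := andP hdelta.
have size_gt0 n (n0 : (0 < n)%N) :
    (0 < Num.truncn ((n%:R : R) `^ delta))%N by case: (top_size hdelta n0).
have corner n (n0 : (0 < n)%N) : (0 < table_size delta n)%N.
  by rewrite addn_gt0 n0 orbT.
have last_lt n (n0 : (0 < n)%N) : (n < table_size delta n)%N.
  exact: table_size_gt.
have top_le n (n0 : (0 < n)%N) : (Num.truncn ((n%:R : R) `^ delta) <= n)%N.
  by case: (top_size hdelta n0).
have rate0 (u v : R) n : 0 <= n%:R `^ u + n%:R `^ v.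
  by rewrite addr_ge0 ?powR_ge0.
have near_gt0 : \forall n \near \oo, (0 < n)%N by exact: nbhs_infty_gt.
have lin n (u v : R) : u <= 2 * n%:R `^ (delta - 1) ->
    u <= 2 * (n%:R `^ (delta - 1) + n%:R `^ v).
  by move=> /le_trans; apply; rewrite ler_pM2l // lerDl powR_ge0.
split; last split.
- move=> _ _ _; apply: (bigO_le (K := 2)) => //.
  apply: filterS2 near_gt0 hX => n n0 Xn; rewrite normr_id; apply: lin.
  have [M0 aE] := @expectation_entry R _ _ (P n) _ (X n) _ _
    (Ordinal (last_lt n n0)) (Ordinal (last_lt n n0)) k Xn hk.
  have hy : C = (if (Ordinal (last_lt n n0) < Num.truncn ((n%:R : R) `^ delta))%N
      then B * C else C) by rewrite ltnNge top_le.
  exact: (bottom_column_rate (j := Ordinal (last_lt n n0)) hB hC hdelta n0 M0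
    (top_le n n0) hy aE).
- move=> /andP[dh d1'] /andP[_ C34] /andP[_ hB'].
  have C1 : C < 1 by apply: lt_le_trans C34 _; lra.
  have q0 : 0 < B * C by rewrite mulr_gt0.
  (* the bound on B is at most 1 / C *)
  have q1 : B * C < 1.
    rewrite -ltr_pdivlMr // -[_ / _]/(1 / C); apply: lt_le_trans hB' _.
    rewrite !div1r lef_pV2 ?posrE // ?ltr_wpDl ?sqrtr_ge0 //.
    by rewrite lerDr sqrtr_ge0.
  have q01 : 0 < B * C < 1 by rewrite q0.
  have C01 : 0 < C < 1 by rewrite hC.
  have hd : 0 <= delta < 1 by rewrite d0.
  have [K hK] := top_left_rate q01 C01 hd heps.
  set c1 := C * (1 - B * C) ^+ 2 in hK; set c2 := (1 - C) * (B * C) ^+ 2 in hK.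
  have c10 : 0 < c1 by rewrite mulr_gt0 // exprn_gt0 // subr_gt0.
  have c20 : 0 < c2 by rewrite mulr_gt0 ?subr_gt0 // exprn_gt0.
  (* c1 + c2 is C^2 times the denominator of the limit *)
  have limE : B ^+ 2 * (1 - C) / (B ^+ 2 - 2 * B + 1 / C) = c2 / (c1 + c2).
    have -> : c1 + c2 = C ^+ 2 * (B ^+ 2 - 2 * B + 1 / C).
      by rewrite /c1 /c2; field; rewrite gt_eqF.
    have -> : c2 = C ^+ 2 * (B ^+ 2 * (1 - C)) by rewrite /c2; ring.
    by rewrite -mulf_div divff ?mul1r // expf_neq0 // gt_eqF.
  apply: (bigO_le (K := K / (c1 + c2))) => //.
  apply: filterS3 near_gt0 hX hK => n n0 Xn hKn; rewrite normr_id limE.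
  have [M0 aE] := @expectation_entry R _ _ (P n) _ (X n) _ _
    (Ordinal (corner n n0)) (Ordinal (corner n n0)) k Xn hk.
  have := hKn (Ordinal (corner n n0)) (size_gt0 n n0); rewrite -aE => hmain.
  have s0 : 0 < c1 + c2 by rewrite addr_gt0.
  have M0' : 0 < #|with_margins (@margin R B C delta n) (@margin R B C delta n)|%:R
    :> R by rewrite ltr0n.
  by apply: le_trans (ratio_near s0 M0' hmain) _; rewrite mulrAC.
- move=> _ _ _; apply: (bigO_le (K := 2)) => //.
  apply: filterS2 near_gt0 hX => n n0 Xn; rewrite normr_id; apply: lin.
  have [M0 aE] := @expectation_entry R _ _ (P n) _ (X n) _ _
    (Ordinal (corner n n0)) (Ordinal (last_lt n n0)) k Xn hk.
  have hy : B * C =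
      (if (Ordinal (corner n n0) < Num.truncn ((n%:R : R) `^ delta))%N
       then B * C else C) by rewrite size_gt0.
  exact: (bottom_column_rate (j := Ordinal (last_lt n n0)) hB hC hdelta n0 M0
    (top_le n n0) hy aE).
Qed.
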